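(* For $p\in\mathbb{R}$, let $T_p$ denote either of the following two operators on $C_0^\infty([0,1])$: $T_p=M_{\omega_p}V: f\mapsto x^p\int_0^x f(t)\,dt$, or $T_p=VM_{\omega_p}: f\mapsto \int_0^x t^p f(t)\,dt$. In both cases the following hold. (i) If $p\geq -1$, then $\sigma(T_p)=\emptyset$ and $\sigma^*(T_p)=\{0\}$. (ii) If $p<-1$, then $\sigma(T_p)=\sigma_p(T_p)=\{\lambda\in\mathbb{C}:\ \mathrm{Re}(\lambda)>0\}$ and $\sigma^*(T_p)=\overline{\sigma(T_p)}$.
   Context: $C_0^\infty([0,1])$ is the space of (complex-valued) functions $f\in C^\infty([0,1])$ with $f^{(k)}(0)=0$ for all $k\in\mathbb{N}_0$, with the Fréchet topology generated by the norms $\|f\|_n=\sup\{|f^{(j)}(x)|: x\in[0,1],\ 0\le j\le n\}$, $n\in\mathbb{N}_0$. $V$ is the Volterra operator $V(f)(x)=\int_0^x f(t)\,dt$. For $p\in\mathbb{R}$, $\omega_p(x)=x^p$ on $(0,1]$, and $M_{\omega_p}$ is the multiplication operator $f\mapsto \omega_p f$ on $C_0^\infty([0,1])$, where $\omega_p f$ is assigned the value $0$ at $x=0$; it maps $C_0^\infty([0,1])$ continuously into itself. For a locally convex space $X$, $\mathcal{L}(X)$ is the space of continuous linear operators on $X$. For $T\in\mathcal{L}(X)$: the resolvent set $\varrho(T)$ is the set of $\lambda\in\mathbb{C}$ such that $\lambda I-T$ has an inverse $R(\lambda,T)=(\lambda I-T)^{-1}\in\mathcal{L}(X)$; the spectrum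 is $\sigma(T)=\mathbb{C}\setminus\varrho(T)$; the point spectrum is $\sigma_p(T)=\{\lambda\in\mathbb{C}: Tx=\lambda x \text{ for some } x\ne 0\}$. The Waelbroeck resolvent set $\varrho^*(T)$ is the set of $\lambda\in\varrho(T)$ for which there is a neighbourhood $V_\lambda\subseteq\varrho(T)$ of $\lambda$ such that $\{R(\mu,T):\mu\in V_\lambda\}$ is an equicontinuous subset of $\mathcal{L}(X)$; the Waelbroeck spectrum is $\sigma^*(T)=\mathbb{C}\setminus\varrho^*(T)$. Closures are taken in $\mathbb{C}$. *)

(* Defs.v *)
From Stdlib Require Import Reals ZArith Lra Lia List ProofIrrelevance FunctionalExtensionality.
From Coquelicot Require Import Coquelicot.
Open Scope R_scope.

(** * Locally convex spaces and spectra of their continuous operators *)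

(** A locally convex space is a complex vector space with a family of seminorms
    that generates its topology. *)
Record lcs : Type := Lcs {
  lcs_space :> ModuleSpace C_Ring;
  lcs_index : Type;
  lcs_seminorm : lcs_index -> lcs_space -> R;
  lcs_triangle : forall i (x y : lcs_space),
    lcs_seminorm i (plus x y) <= lcs_seminorm i x + lcs_seminorm i y;
  lcs_homogeneous : forall i (a : C) (x : lcs_space),
    lcs_seminorm i (scal (a : C_Ring) x) = Cmod a * lcs_seminorm i x
}.

Arguments lcs_seminorm {l} _ _.

Definition lcs_nbhs {X : lcs} (x : X) (U : X -> Prop) : Prop :=
  exists (s : list (lcs_index X)) (eps : posreal),
  forall y : X,
    (forall i, In i s -> lcs_seminorm i (minus y x) < eps) -> U y.

(** The space L(X). *)
Record clin (X : lcs) : Type := Clin {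
  clin_fun :> X -> X;
  clin_plus : forall x y : X, clin_fun (plus x y) = plus (clin_fun x) (clin_fun y);
  clin_scal : forall (a : C) (x : X),
    clin_fun (scal (a : C_Ring) x) = scal (a : C_Ring) (clin_fun x);
  clin_continuous : forall x : X,
    filterlim clin_fun (lcs_nbhs x) (lcs_nbhs (clin_fun x))
}.

Arguments Clin {X} _ _ _ _.
Arguments clin_fun {X} _ _.

Definition clin_comp {X : lcs} (S T : clin X) : clin X.
Proof.
refine (Clin (fun x => S (T x)) _ _ _).
- intros x y. now rewrite 2!clin_plus.
- intros a x. now rewrite 2!clin_scal.
- intros x. apply filterlim_comp with (lcs_nbhs (T x)); apply clin_continuous.
Defined.

Definition is_resolvent {X : lcs} (T : clin X) (lambda : C) (S : clin X) : Prop :=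
  (forall x : X, S (minus (scal (lambda : C_Ring) x) (T x)) = x) /\
  (forall x : X, minus (scal (lambda : C_Ring) (S x)) (T (S x)) = x).

Definition resolvent_set {X : lcs} (T : clin X) (lambda : C) : Prop :=
  exists S : clin X, is_resolvent T lambda S.

Definition spectrum {X : lcs} (T : clin X) (lambda : C) : Prop :=
  ~ resolvent_set T lambda.

Definition point_spectrum {X : lcs} (T : clin X) (lambda : C) : Prop :=
  exists x : X, x <> zero /\ T x = scal (lambda : C_Ring) x.

(** As usual for sets of linear operators, equicontinuity is stated at 0. *)
Definition equicontinuous {X : lcs} (H : clin X -> Prop) : Prop :=
  forall U : X -> Prop, lcs_nbhs zero U ->
  exists W : X -> Prop, lcs_nbhs zero W /\
    forall S : clin X, H S -> forall x : X, W x -> U (S x).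

Definition waelbroeck_resolvent_set {X : lcs} (T : clin X) (lambda : C) : Prop :=
  resolvent_set T lambda /\
  exists W : C -> Prop,
    locally lambda W /\
    (forall mu : C, W mu -> resolvent_set T mu) /\
    equicontinuous (fun S : clin X => exists mu : C, W mu /\ is_resolvent T mu S).

Definition waelbroeck_spectrum {X : lcs} (T : clin X) (lambda : C) : Prop :=
  ~ waelbroeck_resolvent_set T lambda.

Definition closureC (A : C -> Prop) (z : C) : Prop :=
  forall U : C -> Prop, locally z U -> exists w : C, U w /\ A w.

(** * The space of smooth functions on [0,1] that are flat at 0

    A function on [0,1] is represented by the function on R that agrees with it
    on [0,1] and is 0 elsewhere, so that Leibniz equality of representatives is
    equality of functions on [0,1]. *)

Definition I01 (x : R) : Prop := 0 <= x <= 1.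

Lemma I01_dec (x : R) : {I01 x} + {~ I01 x}.
Proof.
unfold I01. destruct (Rle_dec 0 x); destruct (Rle_dec x 1); try (left; lra); right; lra.
Defined.

(** Coquelicot's [is_derive], with the neighbourhoods of x taken in [0,1]
    (hence one-sided at the end points). *)
Definition is_derive01 (f : R -> C) (x : R) (l : C) : Prop :=
  @filterdiff R_AbsRing R_NormedModule C_R_NormedModule
    f (within I01 (locally x)) (fun y : R => scal y l).

(** The value is meaningful only at points where f is differentiable on [0,1]. *)
Definition derive01 (f : R -> C) (x : R) : C :=
  if I01_dec x
  then @iota C_R_CompleteNormedModule (fun l => is_derive01 f x l)
  else 0%C.

Definition derive01_n (n : nat) (f : R -> C) : R -> C := Nat.iter n derive01 f.

Record C0inf : Type := MkC0inf {
  c0_fun :> R -> C;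
  c0_outside : forall x, ~ I01 x -> c0_fun x = 0%C;
  c0_smooth : forall n x, I01 x -> exists l, is_derive01 (derive01_n n c0_fun) x l;
  c0_flat : forall n, derive01_n n c0_fun 0 = 0%C
}.

Definition c0_norm (n : nat) (f : C0inf) : R :=
  real (Lub_Rbar (fun r : R => exists j x,
    (j <= n)%nat /\ I01 x /\ r = Cmod (derive01_n j f x))).

Lemma c0_ext (f g : C0inf) : (forall x, f x = g x) -> f = g.
Proof.
destruct f as [f f1 f2 f3], g as [g g1 g2 g3]; simpl; intros H.
assert (E : f = g) by now apply functional_extensionality.
subst g. f_equal; apply proof_irrelevance.
Qed.

(** ** Derivatives on [0,1] *)

Lemma norm_C_R (z : C) : @norm _ C_R_NormedModule z = Cmod z.
Proof.
change (sqrt (Rabs (fst z) ^ 2 + Rabs (snd z) ^ 2) = sqrt (fst z ^ 2 + snd z ^ 2)).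
now rewrite !RPow_abs, !(Rabs_pos_eq (_ ^ 2)) by apply pow2_ge_0.
Qed.

Lemma increment_C_R (f : R -> C) (x y : R) (l : C) :
  (f y - f x - RtoC (y - x) * l)%C =
  minus (minus (f y) (f x)) (scal (minus y x) l : C_R_NormedModule).
Proof.
destruct (f y) as [a b], (f x) as [c d], l as [u v].
change ((a + - c + - ((y - x) * u - 0 * v), b + - d + - ((y - x) * v + 0 * u)) =
  (a + - c + - ((y + - x) * u), b + - d + - ((y + - x) * v))).
f_equal; ring.
Qed.

Lemma is_derive01_eps (f : R -> C) (x : R) (l : C) : I01 x ->
  is_derive01 f x l <->
  forall eps : posreal, exists d : posreal, forall y, I01 y -> Rabs (y - x) < d ->
    Cmod (f y - f x - RtoC (y - x) * l)%C <= eps * Rabs (y - x).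
Proof.
intros Hx. split.
- intros [_ H] eps.
  assert (L : is_filter_lim (within I01 (locally x)) x).
  { intros P [d Hd]. exists d. intros y Hy _. now apply Hd. }
  destruct (H x L eps) as [d Hd]. exists d. intros y Iy Hy.
  specialize (Hd y Hy Iy).
  replace (f y - f x - RtoC (y - x) * l)%C with
    (minus (minus (f y) (f x)) (scal (minus y x) l : C_R_NormedModule)).
  rewrite <- norm_C_R. exact Hd.
  symmetry. apply increment_C_R.
- intros H. split.
  apply (is_linear_scal_l (V := C_R_NormedModule)).
  intros z Hz.
  assert (E : z = x).
  { destruct (Req_dec z x) as [e|n]; [easy|]. exfalso.
    assert (P : 0 < Rabs (z - x)) by (apply Rabs_pos_lt; lra).
    assert (Q : locally z (fun y => Rabs (y - z) < Rabs (z - x))).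
    { exists (mkposreal _ P). intros y Hy. exact Hy. }
    apply Hz in Q. destruct Q as [d Hd].
    assert (B : ball x d x) by apply ball_center.
    specialize (Hd x B Hx). rewrite Rabs_minus_sym in Hd. lra. }
  subst z. intros eps. destruct (H eps) as [d Hd].
  exists d. intros y Hy Iy. specialize (Hd y Iy Hy).
  replace (f y - f x - RtoC (y - x) * l)%C with
    (minus (minus (f y) (f x)) (scal (minus y x) l : C_R_NormedModule)) in Hd.
  rewrite <- norm_C_R in Hd. exact Hd.
  symmetry. apply increment_C_R.
Qed.

Lemma is_derive01_unique (f : R -> C) (x : R) (l1 l2 : C) : I01 x ->
  is_derive01 f x l1 -> is_derive01 f x l2 -> l1 = l2.
Proof.
intros Hx H1 H2.
rewrite is_derive01_eps in H1, H2 by easy.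
assert (K : forall eps : posreal, Cmod (l2 - l1)%C <= 2 * eps).
{ intros eps. destruct (H1 eps) as [d1 D1], (H2 eps) as [d2 D2].
  set (m := Rmin (1/2) (Rmin d1 d2 / 2)).
  assert (0 < Rmin d1 d2) by (apply Rmin_pos; [apply d1|apply d2]).
  assert (0 < m) by (unfold m; apply Rmin_pos; lra).
  assert (m <= 1/2) by apply Rmin_l.
  assert (m <= Rmin d1 d2 / 2) by apply Rmin_r.
  pose proof (Rmin_l d1 d2). pose proof (Rmin_r d1 d2).
  assert (Y : exists y, I01 y /\ Rabs (y - x) = m).
  { unfold I01 in *. destruct (Rle_dec x (1/2)).
    - exists (x + m). split; [lra|]. replace (x + m - x) with m by ring.
      apply Rabs_pos_eq; lra.
    - exists (x - m). split; [lra|]. replace (x - m - x) with (- m) by ring.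
      rewrite Rabs_Ropp. apply Rabs_pos_eq; lra. }
  destruct Y as [y [Iy Ey]].
  specialize (D1 y Iy). specialize (D2 y Iy). rewrite Ey in D1, D2.
  assert (E1 := D1 ltac:(lra)). assert (E2 := D2 ltac:(lra)).
  assert (T : Cmod (RtoC (y - x) * (l2 - l1))%C <= 2 * eps * m).
  { replace (RtoC (y - x) * (l2 - l1))%C with
      ((f y - f x - RtoC (y - x) * l1) + - (f y - f x - RtoC (y - x) * l2))%C by ring.
    eapply Rle_trans. apply Cmod_triangle. rewrite Cmod_opp. lra. }
  rewrite Cmod_mult, Cmod_R, Ey in T.
  apply Rmult_le_reg_l with m; lra. }
assert (Z : Cmod (l2 - l1)%C = 0).
{ apply Rle_antisym; [|apply Cmod_ge_0].
  apply le_epsilon. intros e He.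
  assert (0 < e / 2) by lra.
  specialize (K (mkposreal _ H)). simpl in K. lra. }
apply Cmod_eq_0 in Z.
replace l1 with (l2 - (l2 - l1))%C by ring. rewrite Z. ring.
Qed.

Lemma derive01_unique (f : R -> C) (x : R) (l : C) : I01 x ->
  is_derive01 f x l -> derive01 f x = l.
Proof.
intros Hx H. unfold derive01. destruct (I01_dec x); [|easy].
apply (iota_unique (V := C_R_CompleteNormedModule)); [|exact H].
intros y Hy. now apply is_derive01_unique with f x.
Qed.

Lemma derive01_correct (f : R -> C) (x : R) : I01 x ->
  (exists l, is_derive01 f x l) -> is_derive01 f x (derive01 f x).
Proof.
intros Hx [l H]. now rewrite (derive01_unique f x l).
Qed.

Lemma derive01_outside (f : R -> C) (x : R) : ~ I01 x -> derive01 f x = 0%C.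
Proof. intros H. unfold derive01. now destruct (I01_dec x). Qed.

Lemma is_derive01_plus (f g : R -> C) (x : R) (l m : C) :
  is_derive01 f x l -> is_derive01 g x m ->
  is_derive01 (fun y => f y + g y)%C x (l + m)%C.
Proof.
intros Hf Hg. unfold is_derive01.
eapply filterdiff_ext_lin.
apply (filterdiff_plus_fct (V := C_R_NormedModule) _ _ _ _ Hf Hg).
intros y. symmetry. exact (scal_distr_l (V := C_R_NormedModule) y l m).
Qed.

Lemma is_derive01_scal (a : C) (f : R -> C) (x : R) (l : C) : I01 x ->
  is_derive01 f x l -> is_derive01 (fun y => a * f y)%C x (a * l)%C.
Proof.
intros Hx. rewrite 2!is_derive01_eps by easy. intros H eps.
assert (P : 0 < eps / (Cmod a + 1)).
{ apply Rdiv_lt_0_compat. apply eps. pose proof (Cmod_ge_0 a). lra. }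
destruct (H (mkposreal _ P)) as [d Hd]. exists d. intros y Iy Hy.
specialize (Hd y Iy Hy). simpl in Hd.
replace (a * f y - a * f x - RtoC (y - x) * (a * l))%C with
  (a * (f y - f x - RtoC (y - x) * l))%C by ring.
rewrite Cmod_mult. pose proof (Cmod_ge_0 a).
eapply Rle_trans. apply Rmult_le_compat_l; [easy|exact Hd].
replace (Cmod a * (eps / (Cmod a + 1) * Rabs (y - x))) with
  (Cmod a / (Cmod a + 1) * (eps * Rabs (y - x))) by (field; lra).
rewrite <- (Rmult_1_l (eps * Rabs (y - x))) at 2.
apply Rmult_le_compat_r.
- apply Rmult_le_pos. left; apply eps. apply Rabs_pos.
- apply Rmult_le_reg_r with (Cmod a + 1); [lra|].
  unfold Rdiv. rewrite Rmult_assoc, Rinv_l by lra. lra.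
Qed.

Lemma is_derive01_scal_real (w : R -> R) (w' : R) (f : R -> C) (x : R) (l : C) :
  I01 x -> is_derive w x w' -> is_derive01 f x l ->
  is_derive01 (fun y => RtoC (w y) * f y)%C x (RtoC w' * f x + RtoC (w x) * l)%C.
Proof.
intros Hx Hw Hf.
assert (L : is_filter_lim (within I01 (locally x)) x).
{ intros P [d Hd]. exists d. intros y Hy _. now apply Hd. }
assert (PF : ProperFilter (within I01 (locally x))).
{ split.
  - intros P [d Hd]. exists x. apply Hd; [apply ball_center|easy].
  - apply within_filter, locally_filter. }
assert (Hw' : filterdiff w (within I01 (locally x)) (fun y : R => scal y w')).
{ eapply (filterdiff_locally (U := R_NormedModule) (V := R_NormedModule)); [exact L|exact Hw]. }
rewrite is_derive01_eps by easy.
assert (Cw : continuous w x) by (apply (ex_derive_continuous (V := R_NormedModule)); now exists w').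
rewrite is_derive01_eps in Hf by easy.
intros eps.
pose proof (Cmod_ge_0 (f x)) as F0. pose proof (Cmod_ge_0 l) as L0.
set (A := Rabs (w x) + 1 + Cmod (f x) + Cmod l).
assert (A1 : 1 <= A) by (unfold A; pose proof (Rabs_pos (w x)); lra).
assert (P : 0 < Rmin 1 (eps / (2 * A))).
{ apply Rmin_pos; [lra|]. apply Rdiv_lt_0_compat; [apply eps|lra]. }
set (e := mkposreal _ P).
assert (e1 : e <= 1) by apply Rmin_l.
assert (e2 : e * (2 * A) <= eps).
{ assert (e <= eps / (2 * A)) by apply Rmin_r.
  apply Rmult_le_compat_r with (r := 2 * A) in H; [|lra].
  unfold Rdiv in H. rewrite Rmult_assoc, Rinv_l in H by lra. lra. }
assert (e0 : 0 < e) by apply e.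
destruct (Hf e) as [d1 H1].
destruct (proj2 Hw' x L e) as [d2 H2].
assert (C3 : locally x (fun y => Rabs (w y - w x) < e)).
{ apply (Cw (fun z => Rabs (z - w x) < e)). exists e. intros z Hz. exact Hz. }
destruct C3 as [d3 H3].
assert (Pd : 0 < Rmin d1 (Rmin d2 d3)).
{ repeat apply Rmin_pos; [apply d1|apply d2|apply d3]. }
exists (mkposreal _ Pd). simpl. intros y Iy Hy.
assert (Y1 : Rabs (y - x) < d1) by (eapply Rlt_le_trans; [exact Hy|apply Rmin_l]).
assert (Y23 : Rabs (y - x) < Rmin d2 d3) by (eapply Rlt_le_trans; [exact Hy|apply Rmin_r]).
assert (Y2 : Rabs (y - x) < d2) by (eapply Rlt_le_trans; [exact Y23|apply Rmin_l]).
assert (Y3 : Rabs (y - x) < d3) by (eapply Rlt_le_trans; [exact Y23|apply Rmin_r]).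
specialize (H1 y Iy Y1). specialize (H2 y Y2 Iy). specialize (H3 y Y3).
change (Rabs (w y - w x - (y - x) * w') <= e * Rabs (y - x)) in H2.
replace (RtoC (w y) * f y - RtoC (w x) * f x -
   RtoC (y - x) * (RtoC w' * f x + RtoC (w x) * l))%C with
  (RtoC (w y) * (f y - f x - RtoC (y - x) * l)
   + (RtoC (w y - w x - (y - x) * w') * f x
      + RtoC (w y - w x) * (RtoC (y - x) * l)))%C
  by (rewrite ?RtoC_minus, ?RtoC_mult, ?RtoC_minus; ring).
eapply Rle_trans. apply Cmod_triangle.
eapply Rle_trans. apply Rplus_le_compat_l. apply Cmod_triangle.
rewrite !Cmod_mult, !Cmod_R.
set (r := Rabs (y - x)) in *.
assert (r0 : 0 <= r) by apply Rabs_pos.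
assert (W : Rabs (w y) <= Rabs (w x) + 1).
{ replace (w y) with (w x + (w y - w x)) by ring.
  eapply Rle_trans. apply Rabs_triang. lra. }
assert (T1 : Rabs (w y) * Cmod (f y - f x - RtoC (y - x) * l)%C <= (Rabs (w x) + 1) * (e * r)).
{ apply Rmult_le_compat; try apply Rabs_pos; try apply Cmod_ge_0; easy. }
assert (T2 : Rabs (w y - w x - (y - x) * w') * Cmod (f x) <= (e * r) * Cmod (f x)).
{ now apply Rmult_le_compat_r. }
assert (T3 : Rabs (w y - w x) * (r * Cmod l) <= e * (r * Cmod l)).
{ apply Rmult_le_compat_r; [now apply Rmult_le_pos|lra]. }
eapply Rle_trans. apply Rplus_le_compat; [exact T1|apply Rplus_le_compat; [exact T2|exact T3]].
replace ((Rabs (w x) + 1) * (e * r) + (e * r * Cmod (f x) + e * (r * Cmod l)))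
  with (e * A * r) by (unfold A; ring).
apply Rmult_le_compat_r; [easy|].
assert (0 <= e * A) by (apply Rmult_le_pos; lra). lra.
Qed.

Lemma is_derive01_ext_loc (f g : R -> C) (x : R) (l : C) (d : posreal) : I01 x ->
  (forall y, I01 y -> Rabs (y - x) < d -> f y = g y) ->
  is_derive01 f x l -> is_derive01 g x l.
Proof.
intros Hx E. rewrite 2!is_derive01_eps by easy. intros H eps.
destruct (H eps) as [d' Hd'].
assert (P : 0 < Rmin d d') by (apply Rmin_pos; [apply d|apply d']).
exists (mkposreal _ P). simpl. intros y Iy Hy.
assert (Rabs (y - x) < d) by (eapply Rlt_le_trans; [exact Hy|apply Rmin_l]).
assert (Rabs (y - x) < d') by (eapply Rlt_le_trans; [exact Hy|apply Rmin_r]).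
rewrite <- (E y), <- (E x) by (try easy; rewrite Rminus_diag, Rabs_R0; apply d).
now apply Hd'.
Qed.

(** ** Closure of flatness under algebraic operations *)

Fixpoint flat_n (n : nat) (f : R -> C) : Prop :=
  f 0 = 0%C /\ (forall x, ~ I01 x -> f x = 0%C) /\
  match n with
  | O => True
  | S n => (forall x, I01 x -> exists l, is_derive01 f x l) /\ flat_n n (derive01 f)
  end.

Definition flat (f : R -> C) : Prop := forall n, flat_n n f.

Lemma derive01_n_S (n : nat) (f : R -> C) :
  derive01_n (S n) f = derive01_n n (derive01 f).
Proof. apply Nat.iter_succ_r. Qed.

Lemma flat_derive (f : R -> C) : flat f -> flat (derive01 f).
Proof. intros H n. apply (H (S n)). Qed.

Lemma flat_derive_n (f : R -> C) (n : nat) : flat f -> flat (derive01_n n f).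
Proof.
intros H. induction n as [|n IH]; [easy|]. now apply flat_derive.
Qed.

Definition flat_C0inf (f : R -> C) (H : flat f) : C0inf.
Proof.
refine (MkC0inf f _ _ _).
- exact (proj1 (proj2 (H O))).
- intros n. exact (proj1 (proj2 (proj2 (flat_derive_n f n H (S O))))).
- intros n. exact (proj1 (flat_derive_n f n H O)).
Defined.

Lemma C0inf_flat (f : C0inf) : flat f.
Proof.
destruct f as [f f1 f2 f3]. simpl. intros n. revert f f1 f2 f3.
induction n as [|n IH]; intros f f1 f2 f3; simpl.
- split; [apply (f3 O)|now split].
- split; [apply (f3 O)|]. split; [easy|]. split; [apply (f2 O)|].
  apply IH.
  + intros x. apply derive01_outside.
  + intros k x Hx. rewrite <- derive01_n_S. now apply f2.
  + intros k. rewrite <- derive01_n_S. apply f3.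
Qed.

Definition c0_derive (f : C0inf) : C0inf :=
  flat_C0inf (derive01 f) (flat_derive f (C0inf_flat f)).

Lemma flat_diff (f : R -> C) (x : R) : flat f -> I01 x ->
  is_derive01 f x (derive01 f x).
Proof. intros H Hx. apply derive01_correct; [easy|]. now apply (H 1%nat). Qed.

Lemma derive01_plus (f g : R -> C) :
  (forall x, I01 x -> exists l, is_derive01 f x l) ->
  (forall x, I01 x -> exists l, is_derive01 g x l) ->
  derive01 (fun x => f x + g x)%C = (fun x => derive01 f x + derive01 g x)%C.
Proof.
intros Hf Hg. apply functional_extensionality. intros x.
destruct (I01_dec x) as [Hx|Hx].
- apply derive01_unique; [easy|].
  apply is_derive01_plus; apply derive01_correct; auto.
- rewrite !derive01_outside by easy. ring.
Qed.

Lemma derive01_scal (a : C) (f : R -> C) :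
  (forall x, I01 x -> exists l, is_derive01 f x l) ->
  derive01 (fun x => a * f x)%C = (fun x => a * derive01 f x)%C.
Proof.
intros Hf. apply functional_extensionality. intros x.
destruct (I01_dec x) as [Hx|Hx].
- apply derive01_unique; [easy|].
  apply is_derive01_scal; [easy|]. apply derive01_correct; auto.
- rewrite !derive01_outside by easy. ring.
Qed.

Lemma flat_n_plus (n : nat) : forall f g : R -> C,
  flat_n n f -> flat_n n g -> flat_n n (fun x => f x + g x)%C.
Proof.
induction n as [|n IH]; intros f g; simpl; intros (f1 & f2 & f3) (g1 & g2 & g3).
- split; [rewrite f1, g1; ring|]. split; [|easy].
  intros x Hx. rewrite f2, g2 by easy. ring.
- destruct f3 as [f3 f4], g3 as [g3 g4].
  split; [rewrite f1, g1; ring|]. split.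
  { intros x Hx. rewrite f2, g2 by easy. ring. }
  split.
  + intros x Hx. destruct (f3 x Hx) as [l Hl], (g3 x Hx) as [m Hm].
    exists (l + m)%C. now apply is_derive01_plus.
  + rewrite derive01_plus by easy. now apply IH.
Qed.

Lemma flat_n_scal (a : C) (n : nat) : forall f : R -> C,
  flat_n n f -> flat_n n (fun x => a * f x)%C.
Proof.
induction n as [|n IH]; intros f; simpl; intros (f1 & f2 & f3).
- split; [rewrite f1; ring|]. split; [|easy].
  intros x Hx. rewrite f2 by easy. ring.
- destruct f3 as [f3 f4].
  split; [rewrite f1; ring|]. split.
  { intros x Hx. rewrite f2 by easy. ring. }
  split.
  + intros x Hx. destruct (f3 x Hx) as [l Hl].
    exists (a * l)%C. now apply is_derive01_scal.
  + rewrite derive01_scal by easy. now apply IH.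
Qed.

Lemma flat_plus (f g : R -> C) : flat f -> flat g -> flat (fun x => f x + g x)%C.
Proof. intros Hf Hg n. now apply flat_n_plus. Qed.

Lemma flat_scal (a : C) (f : R -> C) : flat f -> flat (fun x => a * f x)%C.
Proof. intros Hf n. now apply flat_n_scal. Qed.

Lemma flat_zero : flat (fun _ => 0%C).
Proof.
intros n. induction n as [|n IH]; simpl; [easy|].
assert (D : forall x, I01 x -> is_derive01 (fun _ => 0%C) x 0%C).
{ intros x Hx. apply is_derive01_eps; [easy|]. intros eps. exists eps. intros y _ _.
  replace (0 - 0 - RtoC (y - x) * 0)%C with (RtoC 0) by ring.
  rewrite Cmod_0. apply Rmult_le_pos; [left; apply eps|apply Rabs_pos]. }
split; [easy|]. split; [easy|]. split.
- intros x Hx. exists 0%C. auto.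
- enough (E : derive01 (fun _ => 0%C) = (fun _ => 0%C)) by now rewrite E.
  apply functional_extensionality. intros x. destruct (I01_dec x) as [Hx|Hx].
  + apply derive01_unique; auto.
  + now rewrite derive01_outside.
Qed.

Lemma derive01_n_plus (n : nat) : forall f g : R -> C, flat f -> flat g ->
  forall x, derive01_n n (fun x => f x + g x)%C x = (derive01_n n f x + derive01_n n g x)%C.
Proof.
induction n as [|n IH]; intros f g Hf Hg x; [easy|].
rewrite !derive01_n_S, derive01_plus by (apply (Hf 1%nat) || apply (Hg 1%nat)).
apply IH; now apply flat_derive.
Qed.

Lemma derive01_n_scal (a : C) (n : nat) : forall f : R -> C, flat f ->
  forall x, derive01_n n (fun x => a * f x)%C x = (a * derive01_n n f x)%C.
Proof.
induction n as [|n IH]; intros f Hf x; [easy|].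
rewrite !derive01_n_S, derive01_scal by apply (Hf 1%nat).
apply IH; now apply flat_derive.
Qed.

(** ** The vector space structure *)

Definition c0_plus (f g : C0inf) : C0inf :=
  flat_C0inf (fun x => f x + g x)%C (flat_plus f g (C0inf_flat f) (C0inf_flat g)).
Definition c0_scal (a : C) (f : C0inf) : C0inf :=
  flat_C0inf (fun x => a * f x)%C (flat_scal a f (C0inf_flat f)).
Definition c0_zero : C0inf := flat_C0inf (fun _ => 0%C) flat_zero.
Definition c0_opp (f : C0inf) : C0inf := c0_scal (-(1))%C f.

Lemma c0_plus_comm (f g : C0inf) : c0_plus f g = c0_plus g f.
Proof. apply c0_ext. intros x. simpl. ring. Qed.
Lemma c0_plus_assoc (f g h : C0inf) : c0_plus f (c0_plus g h) = c0_plus (c0_plus f g) h.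
Proof. apply c0_ext. intros x. simpl. ring. Qed.
Lemma c0_plus_zero (f : C0inf) : c0_plus f c0_zero = f.
Proof. apply c0_ext. intros x. simpl. ring. Qed.
Lemma c0_plus_opp (f : C0inf) : c0_plus f (c0_opp f) = c0_zero.
Proof. apply c0_ext. intros x. simpl. ring. Qed.

Definition c0_AbelianMonoid_mixin :=
  AbelianMonoid.Mixin C0inf c0_plus c0_zero c0_plus_comm c0_plus_assoc c0_plus_zero.
Canonical c0_AbelianMonoid :=
  AbelianMonoid.Pack C0inf c0_AbelianMonoid_mixin C0inf.
Definition c0_AbelianGroup_mixin :=
  AbelianGroup.Mixin c0_AbelianMonoid c0_opp c0_plus_opp.
Canonical c0_AbelianGroup := AbelianGroup.Pack C0inf
  (AbelianGroup.Class _ c0_AbelianMonoid_mixin c0_AbelianGroup_mixin) C0inf.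

Lemma c0_scal_assoc (a b : C_Ring) (f : c0_AbelianGroup) :
  c0_scal a (c0_scal b f) = c0_scal (mult a b) f.
Proof. apply c0_ext. intros x. simpl. unfold mult; simpl. ring. Qed.
Lemma c0_scal_one (f : c0_AbelianGroup) : c0_scal (one : C_Ring) f = f.
Proof. apply c0_ext. intros x. simpl. unfold one; simpl. ring. Qed.
Lemma c0_scal_distr_l (a : C_Ring) (f g : c0_AbelianGroup) :
  c0_scal a (plus f g) = plus (c0_scal a f) (c0_scal a g).
Proof. apply c0_ext. intros x. simpl. ring. Qed.
Lemma c0_scal_distr_r (a b : C_Ring) (f : c0_AbelianGroup) :
  c0_scal (plus a b) f = plus (c0_scal a f) (c0_scal b f).
Proof. apply c0_ext. intros x. simpl. unfold plus at 1; simpl. ring. Qed.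

Definition c0_ModuleSpace_mixin :=
  ModuleSpace.Mixin C_Ring c0_AbelianGroup c0_scal
    c0_scal_assoc c0_scal_one c0_scal_distr_l c0_scal_distr_r.
Canonical c0_ModuleSpace := ModuleSpace.Pack C_Ring C0inf
  (ModuleSpace.Class C_Ring C0inf _ c0_ModuleSpace_mixin) C0inf.

(** ** The norms *)

Definition clamp (x : R) : R := Rmax 0 (Rmin 1 x).

Lemma clamp_I01 (x : R) : I01 (clamp x).
Proof. unfold I01, clamp, Rmax, Rmin. repeat destruct (Rle_dec _ _); lra. Qed.

Lemma clamp_id (x : R) : I01 x -> clamp x = x.
Proof. unfold I01, clamp, Rmax, Rmin. repeat destruct (Rle_dec _ _); lra. Qed.

Lemma clamp_lip (x y : R) : Rabs (clamp y - clamp x) <= Rabs (y - x).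
Proof.
unfold clamp, Rmax, Rmin, Rabs.
repeat destruct (Rle_dec _ _); repeat destruct (Rcase_abs _); lra.
Qed.

Lemma clamp_continuous (f : R -> C) :
  (forall x, I01 x -> exists l, is_derive01 f x l) ->
  forall x (eps : posreal), exists d : posreal, forall y, Rabs (y - x) < d ->
    Cmod (f (clamp y) - f (clamp x))%C < eps.
Proof.
intros Hf x eps.
destruct (Hf _ (clamp_I01 x)) as [l Hl].
rewrite is_derive01_eps in Hl by apply clamp_I01.
destruct (Hl (mkposreal 1 Rlt_0_1)) as [d Hd]. simpl in Hd.
pose proof (Cmod_ge_0 l) as L0.
assert (P : 0 < Rmin d (eps / (2 + Cmod l))).
{ apply Rmin_pos; [apply d|]. apply Rdiv_lt_0_compat; [apply eps|lra]. }
exists (mkposreal _ P). simpl. intros y Hy.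
assert (H1 : Rabs (y - x) < d) by (eapply Rlt_le_trans; [exact Hy|apply Rmin_l]).
assert (H2 : Rabs (y - x) < eps / (2 + Cmod l)) by (eapply Rlt_le_trans; [exact Hy|apply Rmin_r]).
pose proof (clamp_lip x y) as Hc.
specialize (Hd (clamp y) (clamp_I01 y) ltac:(lra)).
set (r := Rabs (clamp y - clamp x)) in *.
assert (r0 : 0 <= r) by apply Rabs_pos.
replace (f (clamp y) - f (clamp x))%C with
  ((f (clamp y) - f (clamp x) - RtoC (clamp y - clamp x) * l)
   + RtoC (clamp y - clamp x) * l)%C by ring.
eapply Rle_lt_trans. apply Cmod_triangle.
rewrite Cmod_mult, Cmod_R. fold r.
assert (r * (2 + Cmod l) < eps).
{ apply Rmult_lt_reg_r with (/ (2 + Cmod l)).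
  - apply Rinv_0_lt_compat; lra.
  - rewrite Rmult_assoc, Rinv_r by lra. unfold Rdiv in H2. lra. }
nra.
Qed.

Lemma clamp_continuous_C (f : R -> C) :
  (forall x, I01 x -> exists l, is_derive01 f x l) ->
  forall x, @continuous R_UniformSpace C_R_CompleteNormedModule (fun y => f (clamp y)) x.
Proof.
intros Hf x.
apply (proj2 (filterlim_locally (U := C_R_CompleteNormedModule) _ _)).
intros eps. destruct (clamp_continuous f Hf x eps) as [d Hd].
exists d. intros y Hy. specialize (Hd y Hy).
pose proof (Rmax_Cmod (f (clamp y) - f (clamp x))%C) as B.
split.
- change (Rabs (fst (f (clamp y)) - fst (f (clamp x))) < eps).
  eapply Rle_lt_trans; [|exact Hd]. eapply Rle_trans; [|exact B]. apply Rmax_l.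
- change (Rabs (snd (f (clamp y)) - snd (f (clamp x))) < eps).
  eapply Rle_lt_trans; [|exact Hd]. eapply Rle_trans; [|exact B]. apply Rmax_r.
Qed.

Lemma Cmod_diff (a b : C) : Rabs (Cmod a - Cmod b) <= Cmod (a - b)%C.
Proof.
apply Rabs_le. split.
- pose proof (Cmod_triangle a (b - a)%C) as H.
  replace (a + (b - a))%C with b in H by ring.
  replace (b - a)%C with (- (a - b))%C in H by ring. rewrite Cmod_opp in H. lra.
- pose proof (Cmod_triangle b (a - b)%C) as H.
  replace (b + (a - b))%C with a in H by ring. lra.
Qed.

Lemma derive01_bounded (f : R -> C) :
  (forall x, I01 x -> exists l, is_derive01 f x l) ->
  exists B, forall x, I01 x -> Cmod (f x) <= B.
Proof.
intros Hf.
destruct (continuity_ab_maj (fun x => Cmod (f (clamp x))) 0 1) as [m [Hm _]]; [lra| |].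
- intros c _. apply continuity_pt_locally.
  intros eps. destruct (clamp_continuous f Hf c eps) as [d Hd].
  exists d. intros y Hy. eapply Rle_lt_trans. apply Cmod_diff. now apply Hd.
- exists (Cmod (f (clamp m))). intros x Hx.
  rewrite <- (clamp_id x Hx) at 1. apply Hm. exact Hx.
Qed.

Lemma derive01_n_bounded (n : nat) (f : C0inf) :
  exists B, forall j x, (j <= n)%nat -> I01 x -> Cmod (derive01_n j f x) <= B.
Proof.
induction n as [|n [B IH]].
- destruct (derive01_bounded f (c0_smooth f O)) as [B HB].
  exists B. intros j x Hj Hx. replace j with O by lia. now apply HB.
- destruct (derive01_bounded _ (c0_smooth f (S n))) as [B' HB'].
  exists (Rmax B B'). intros j x Hj Hx.
  destruct (Nat.eq_dec j (S n)) as [->|E].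
  + eapply Rle_trans; [now apply HB'|apply Rmax_r].
  + eapply Rle_trans; [apply IH; [lia|easy]|apply Rmax_l].
Qed.

Lemma c0_norm_lub (n : nat) (f : C0inf) :
  is_lub_Rbar (fun r : R => exists j x,
    (j <= n)%nat /\ I01 x /\ r = Cmod (derive01_n j f x)) (c0_norm n f).
Proof.
unfold c0_norm.
match goal with |- is_lub_Rbar ?E _ => set (A := E) end.
pose proof (Lub_Rbar_correct A) as H.
destruct (derive01_n_bounded n f) as [B HB].
assert (H0 : A (Cmod (f 0))).
{ exists O, 0. split; [lia|]. split; [unfold I01; lra|easy]. }
assert (U : is_ub_Rbar A B).
{ intros r (j & x & Hj & Hx & ->). now apply HB. }
pose proof (proj1 H _ H0) as L. pose proof (proj2 H _ U) as G.
destruct (Lub_Rbar A) as [r| |]; easy.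
Qed.

Lemma c0_norm_ge (n j : nat) (f : C0inf) (x : R) : (j <= n)%nat -> I01 x ->
  Cmod (derive01_n j f x) <= c0_norm n f.
Proof.
intros Hj Hx. apply (proj1 (c0_norm_lub n f) (Cmod (derive01_n j f x))).
now exists j, x.
Qed.

Lemma c0_norm_le (n : nat) (f : C0inf) (B : R) :
  (forall j x, (j <= n)%nat -> I01 x -> Cmod (derive01_n j f x) <= B) ->
  c0_norm n f <= B.
Proof.
intros H. apply (proj2 (c0_norm_lub n f) (Finite B)).
intros r (j & x & Hj & Hx & ->). now apply H.
Qed.

Lemma c0_norm_ge_0 (n : nat) (f : C0inf) : 0 <= c0_norm n f.
Proof.
eapply Rle_trans; [apply (Cmod_ge_0 (derive01_n 0 f 0))|].
apply c0_norm_ge; [lia|unfold I01; lra].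
Qed.

Lemma c0_norm_mono (n m : nat) (f : C0inf) : (n <= m)%nat -> c0_norm n f <= c0_norm m f.
Proof.
intros H. apply c0_norm_le. intros j x Hj Hx. apply c0_norm_ge; [lia|easy].
Qed.

Lemma c0_norm_derive (n : nat) (f : C0inf) : c0_norm n (c0_derive f) <= c0_norm (S n) f.
Proof.
apply c0_norm_le. intros j x Hj Hx. simpl. rewrite <- derive01_n_S.
apply c0_norm_ge; [lia|easy].
Qed.

Lemma c0_norm_triangle (n : nat) (f g : c0_ModuleSpace) :
  c0_norm n (plus f g) <= c0_norm n f + c0_norm n g.
Proof.
apply c0_norm_le. intros j x Hj Hx. simpl.
rewrite derive01_n_plus by apply C0inf_flat.
eapply Rle_trans; [apply Cmod_triangle|].
apply Rplus_le_compat; now apply c0_norm_ge.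
Qed.

Lemma c0_norm_homogeneous (n : nat) (a : C) (f : c0_ModuleSpace) :
  c0_norm n (scal (a : C_Ring) f) = Cmod a * c0_norm n f.
Proof.
assert (U : forall (b : C) (g : C0inf), c0_norm n (c0_scal b g) <= Cmod b * c0_norm n g).
{ intros b g. apply c0_norm_le. intros j x Hj Hx. simpl.
  rewrite derive01_n_scal by apply C0inf_flat. rewrite Cmod_mult.
  apply Rmult_le_compat_l; [apply Cmod_ge_0|now apply c0_norm_ge]. }
apply Rle_antisym; [apply U|].
change (Cmod a * c0_norm n f <= c0_norm n (c0_scal a f)).
destruct (Ceq_dec a 0%C) as [->|Ha].
- rewrite Cmod_0, Rmult_0_l. apply c0_norm_ge_0.
- pose proof (U (/ a)%C (c0_scal a f)) as H.
  replace (c0_scal (/ a)%C (c0_scal a f)) with (f : C0inf) in H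
    by (apply c0_ext; intros x; simpl; field; easy).
  rewrite Cmod_inv in H by easy.
  assert (P : 0 < Cmod a) by now apply Cmod_gt_0.
  apply Rmult_le_compat_l with (r := Cmod a) in H; [|lra].
  rewrite <- Rmult_assoc, Rinv_r, Rmult_1_l in H by lra. exact H.
Qed.

Definition c0_lcs : lcs :=
  Lcs c0_ModuleSpace nat c0_norm c0_norm_triangle c0_norm_homogeneous.

Lemma lcs_bounded_continuous (X : lcs) (T : X -> X) :
  (forall x y, T (plus x y) = plus (T x) (T y)) ->
  (forall (a : C) x, T (scal (a : C_Ring) x) = scal (a : C_Ring) (T x)) ->
  (forall i, exists j K, 0 <= K /\
     forall x, lcs_seminorm i (T x) <= K * lcs_seminorm j x) ->
  forall x : X, filterlim T (lcs_nbhs x) (lcs_nbhs (T x)).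
Proof.
intros Tp Ts Tb x U [s [eps HU]].
assert (Tm : forall y, minus (T y) (T x) = T (minus y x)).
{ intros y. unfold minus. rewrite Tp. f_equal.
  rewrite <- 2!scal_opp_one. symmetry. apply Ts. }
assert (A : exists (s' : list (lcs_index X)) (d : posreal), forall y,
   (forall j, In j s' -> lcs_seminorm j (minus y x) < d) ->
   forall i, In i s -> lcs_seminorm i (minus (T y) (T x)) < eps).
{ clear HU. induction s as [|i s [s' [d IH]]].
  - exists nil, eps. intros y _ i [].
  - destruct (Tb i) as [j [K [HK Hj]]].
    assert (P : 0 < Rmin d (eps / (K + 1))).
    { apply Rmin_pos; [apply d|]. apply Rdiv_lt_0_compat; [apply eps|lra]. }
    exists (j :: s'), (mkposreal _ P). simpl. intros y Hy i' [<-|Hi'].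
    + rewrite Tm. eapply Rle_lt_trans; [apply Hj|].
      specialize (Hy j (or_introl eq_refl)).
      assert (Q : lcs_seminorm j (minus y x) < eps / (K + 1))
        by (eapply Rlt_le_trans; [exact Hy|apply Rmin_r]).
      assert (0 < eps / (K + 1)) by (apply Rdiv_lt_0_compat; [apply eps|lra]).
      assert (E : (K + 1) * (eps / (K + 1)) = eps) by (field; lra).
      set (q := lcs_seminorm j (minus y x)) in *. nra.
    + apply IH; [|easy]. intros k Hk.
      eapply Rlt_le_trans; [apply Hy; now right|apply Rmin_l]. }
destruct A as [s' [d HA]]. exists s', d. intros y Hy. apply HU. now apply HA.
Qed.

(** ** Volterra and multiplication operators *)

(** [volterra_fun] and [power_fun] return representatives: both vanish off [0,1]
    ([power_fun] because its argument does). *)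
Definition volterra_fun (f : R -> C) (x : R) : C :=
  if I01_dec x then @RInt C_R_CompleteNormedModule f 0 x else 0%C.

Lemma ex_RInt_clamp (f : R -> C) (a b : R) :
  (forall x, I01 x -> exists l, is_derive01 f x l) ->
  @ex_RInt C_R_NormedModule (fun y => f (clamp y)) a b.
Proof.
intros Hf. apply (ex_RInt_continuous (V := C_R_CompleteNormedModule)).
intros z _. now apply clamp_continuous_C.
Qed.

Lemma RInt_clamp (f : R -> C) (x : R) : I01 x ->
  @RInt C_R_CompleteNormedModule f 0 x =
  @RInt C_R_CompleteNormedModule (fun y => f (clamp y)) 0 x.
Proof.
intros Hx. apply (RInt_ext (V := C_R_CompleteNormedModule)). intros y Hy. unfold I01 in Hx.
rewrite Rmin_left, Rmax_right in Hy by lra.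
now rewrite clamp_id by (unfold I01; lra).
Qed.

Lemma ex_RInt_01 (f : R -> C) (x : R) : I01 x ->
  (forall x, I01 x -> exists l, is_derive01 f x l) ->
  @ex_RInt C_R_NormedModule f 0 x.
Proof.
intros Hx Hf. eapply (ex_RInt_ext (V := C_R_NormedModule)); [|apply (ex_RInt_clamp f 0 x Hf)].
intros y Hy. unfold I01 in Hx.
rewrite Rmin_left, Rmax_right in Hy by lra. simpl.
now rewrite clamp_id by (unfold I01; lra).
Qed.

Lemma volterra_is_derive01 (f : R -> C) (x : R) : I01 x ->
  (forall x, I01 x -> exists l, is_derive01 f x l) ->
  is_derive01 (volterra_fun f) x (f x).
Proof.
intros Hx Hf.
apply is_derive01_ext_loc with
  (fun y => @RInt C_R_CompleteNormedModule (fun y => f (clamp y)) 0 y) (mkposreal 1 Rlt_0_1);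
  [easy| |].
- intros y Hy _. unfold volterra_fun. destruct (I01_dec y); [|easy].
  symmetry. now apply RInt_clamp.
- unfold is_derive01.
  assert (PF : ProperFilter (within I01 (locally x))).
  { split.
    - intros P [d Hd]. exists x. apply Hd; [apply ball_center|easy].
    - apply within_filter, locally_filter. }
  apply (filterdiff_locally (U := R_NormedModule) (V := C_R_NormedModule)) with x.
  + intros P [d Hd]. exists d. intros y Hy _. now apply Hd.
  + replace (f x) with (f (clamp x)) by (now rewrite clamp_id).
    apply (is_derive_RInt (V := C_R_NormedModule) (fun y => f (clamp y)) _ 0 x).
    * apply filter_forall. intros y.
      apply (RInt_correct (V := C_R_CompleteNormedModule)).
      now apply ex_RInt_clamp.
    * now apply clamp_continuous_C.
Qed.

Lemma derive01_volterra (f : R -> C) : flat f -> derive01 (volterra_fun f) = f.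
Proof.
intros Hf. apply functional_extensionality. intros x.
destruct (I01_dec x) as [Hx|Hx].
- apply derive01_unique; [easy|]. apply volterra_is_derive01; [easy|apply (Hf 1%nat)].
- rewrite derive01_outside by easy. symmetry. now apply (Hf O).
Qed.

Lemma volterra_flat (f : R -> C) : flat f -> flat (volterra_fun f).
Proof.
intros Hf n.
assert (H0 : volterra_fun f 0 = 0%C).
{ unfold volterra_fun. destruct (I01_dec 0); [|easy].
  apply (RInt_point (V := C_R_CompleteNormedModule)). }
assert (H1 : forall x, ~ I01 x -> volterra_fun f x = 0%C).
{ intros x Hx. unfold volterra_fun. now destruct (I01_dec x). }
destruct n as [|n]; simpl; [easy|].
split; [easy|]. split; [easy|]. split.
- intros x Hx. exists (f x). apply volterra_is_derive01; [easy|apply (Hf 1%nat)].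
- rewrite derive01_volterra; auto.
Qed.

Definition volterra (f : C0inf) : C0inf :=
  flat_C0inf (volterra_fun f) (volterra_flat f (C0inf_flat f)).

Lemma volterra_plus (f g : c0_lcs) :
  volterra (plus f g) = plus (volterra f) (volterra g) :> c0_lcs.
Proof.
apply c0_ext. intros x. simpl. unfold volterra_fun.
destruct (I01_dec x) as [Hx|Hx]; [|ring].
apply (RInt_plus (V := C_R_CompleteNormedModule));
  (apply ex_RInt_01; [easy|]).
- apply (C0inf_flat f 1%nat).
- apply (C0inf_flat g 1%nat).
Qed.

Lemma is_RInt_Cmult (a : C) (f : R -> C) (x y : R) (l : C) :
  @is_RInt C_R_NormedModule f x y l ->
  @is_RInt C_R_NormedModule (fun t => a * f t)%C x y (a * l)%C.
Proof.
intros H.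
pose proof (is_RInt_fct_extend_fst (U := R_NormedModule) (V := R_NormedModule) _ _ _ _ H) as H1.
pose proof (is_RInt_fct_extend_snd (U := R_NormedModule) (V := R_NormedModule) _ _ _ _ H) as H2.
apply (is_RInt_fct_extend_pair (U := R_NormedModule) (V := R_NormedModule)).
- apply (is_RInt_minus (V := R_NormedModule)); now apply (is_RInt_scal (V := R_NormedModule)).
- apply (is_RInt_plus (V := R_NormedModule)); now apply (is_RInt_scal (V := R_NormedModule)).
Qed.

Lemma volterra_scal (a : C) (f : c0_lcs) :
  volterra (scal (a : C_Ring) f) = scal (a : C_Ring) (volterra f) :> c0_lcs.
Proof.
apply c0_ext. intros x. simpl. unfold volterra_fun.
destruct (I01_dec x) as [Hx|Hx]; [|ring].
assert (E : @ex_RInt C_R_NormedModule f 0 x).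
{ apply ex_RInt_01; [easy|]. apply (C0inf_flat f 1%nat). }
apply (RInt_correct (V := C_R_CompleteNormedModule)) in E.
apply (is_RInt_unique (V := C_R_CompleteNormedModule)).
now apply is_RInt_Cmult.
Qed.

Lemma volterra_bounded (n : nat) : exists m K, 0 <= K /\
  forall f : C0inf, c0_norm n (volterra f) <= K * c0_norm m f.
Proof.
exists n, 1. split; [lra|]. intros f. rewrite Rmult_1_l.
apply c0_norm_le. intros [|j] x Hj Hx; simpl volterra.
- simpl. unfold volterra_fun. destruct (I01_dec x); [|easy].
  unfold I01 in Hx.
  assert (E : @ex_RInt C_R_NormedModule f 0 x).
  { apply ex_RInt_01; [easy|]. apply (C0inf_flat f 1%nat). }
  apply (RInt_correct (V := C_R_CompleteNormedModule)) in E.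
  assert (N : @norm _ C_R_NormedModule (@RInt C_R_CompleteNormedModule f 0 x)
              <= (x - 0) * c0_norm n f).
  { apply (norm_RInt_le_const (V := C_R_NormedModule) f 0 x); [lra| |exact E].
    intros t Ht. rewrite norm_C_R. apply (c0_norm_ge n 0 f t); [lia|unfold I01; lra]. }
  rewrite norm_C_R in N.
  pose proof (c0_norm_ge_0 n f).
  eapply Rle_trans; [exact N|]. nra.
- rewrite derive01_n_S. change (c0_fun (volterra f)) with (volterra_fun f).
  rewrite derive01_volterra by apply C0inf_flat.
  apply c0_norm_ge; [lia|easy].
Qed.

Definition volterra_op : clin c0_lcs :=
  @Clin c0_lcs volterra volterra_plus volterra_scal
    (lcs_bounded_continuous c0_lcs volterra volterra_plus volterra_scal volterra_bounded).

(** f |-> x^p f, with value 0 at x = 0. *)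
Definition power_fun (p : R) (f : R -> C) (x : R) : C :=
  if Rlt_dec 0 x then (RtoC (Rpower x p) * f x)%C else 0%C.

Lemma is_derive01_re (f : R -> C) (z : C) (t : R) (l : C) : 0 < t < 1 ->
  is_derive01 f t l -> is_derive (fun y => Re (z * f (clamp y))%C) t (Re (z * l)%C).
Proof.
intros Ht H.
assert (It : I01 t) by (unfold I01; lra).
apply is_derive01_scal with (a := z) in H; [|easy].
rewrite is_derive01_eps in H by easy.
apply is_derive_Reals. intros eps Heps.
assert (E2 : 0 < eps / 2) by lra.
destruct (H (mkposreal _ E2)) as [d Hd]. simpl in Hd.
assert (P : 0 < Rmin d (Rmin t (1 - t))).
{ repeat apply Rmin_pos; try lra. apply d. }
exists (mkposreal _ P). simpl. intros h Hh Hh'.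
assert (h1 : Rabs h < d) by (eapply Rlt_le_trans; [exact Hh'|apply Rmin_l]).
assert (h2 : Rabs h < Rmin t (1 - t)) by (eapply Rlt_le_trans; [exact Hh'|apply Rmin_r]).
assert (h3 : Rabs h < t) by (eapply Rlt_le_trans; [exact h2|apply Rmin_l]).
assert (h4 : Rabs h < 1 - t) by (eapply Rlt_le_trans; [exact h2|apply Rmin_r]).
apply Rabs_def2 in h3. apply Rabs_def2 in h4.
assert (Ith : I01 (t + h)) by (unfold I01; lra).
specialize (Hd (t + h) Ith).
replace (t + h - t) with h in Hd by ring. specialize (Hd h1).
rewrite !clamp_id by easy.
set (D := (z * f (t + h)%R - z * f t - RtoC h * (z * l))%C) in *.
assert (RD : Rabs (Re D) <= eps / 2 * Rabs h).
{ eapply Rle_trans; [apply Rmax_l|]. eapply Rle_trans; [apply (Rmax_Cmod D)|]. exact Hd. }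
assert (ED : Re D = Re (z * f (t + h)%R)%C - Re (z * f t)%C - h * Re (z * l)%C).
{ unfold D. simpl. ring. }
change (Rabs ((Re (z * f (t + h)%R)%C - Re (z * f t)%C) / h - Re (z * l)%C) < eps).
replace ((Re (z * f (t + h)%R)%C - Re (z * f t)%C) / h - Re (z * l)%C) with (Re D / h)
  by (rewrite ED; field; easy).
assert (Ph : 0 < Rabs h) by now apply Rabs_pos_lt.
unfold Rdiv at 1. rewrite Rabs_mult, Rabs_inv.
apply Rmult_lt_reg_r with (Rabs h); [easy|].
rewrite Rmult_assoc, Rinv_l by lra. rewrite Rmult_1_r.
eapply Rle_lt_trans; [exact RD|]. nra.
Qed.

Lemma mvt01 (f : R -> C) (K x : R) : I01 x ->
  (forall x, I01 x -> exists l, is_derive01 f x l) ->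
  (forall t, 0 <= t <= x -> Cmod (derive01 f t) <= K) ->
  Cmod (f x - f 0)%C <= K * x.
Proof.
intros Hx Hf HK.
set (z := (f x - f 0)%C).
set (u := fun y => Re (Cconj z * f (clamp y))%C).
unfold I01 in Hx.
destruct (Req_dec x 0) as [E|Nx].
{ assert (z = 0%C) as -> by (unfold z; rewrite E; ring).
  rewrite Cmod_0, E. lra. }
destruct (MVT_gen u 0 x (fun t => Re (Cconj z * derive01 f t)%C)) as [c [Hc Ec]].
- rewrite Rmin_left, Rmax_right by lra. intros t Ht.
  apply is_derive01_re; [lra|].
  apply derive01_correct; [unfold I01; lra|apply Hf; unfold I01; lra].
- intros t _. apply continuity_pt_locally. intros eps.
  assert (P : 0 < eps / (Cmod z + 1)).
  { apply Rdiv_lt_0_compat; [apply eps|pose proof (Cmod_ge_0 z); lra]. }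
  destruct (clamp_continuous f Hf t (mkposreal _ P)) as [d Hd]. simpl in Hd.
  exists d. intros y Hy. specialize (Hd y Hy).
  replace (u y - u t) with (Re (Cconj z * (f (clamp y) - f (clamp t)))%C)
    by (unfold u; simpl; ring).
  eapply Rle_lt_trans; [apply Rmax_l|].
  eapply Rle_lt_trans; [apply Rmax_Cmod|].
  rewrite Cmod_mult, Cmod_conj. pose proof (Cmod_ge_0 z).
  pose proof (Cmod_ge_0 (f (clamp y) - f (clamp t))%C).
  assert (E : (Cmod z + 1) * (eps / (Cmod z + 1)) = eps) by (field; lra).
  nra.
- rewrite Rmin_left, Rmax_right in Hc by lra.
  assert (Eu : u x - u 0 = Cmod z ^ 2).
  { unfold u. rewrite !clamp_id by (unfold I01; lra).
    unfold Cmod. rewrite pow2_sqrt by nra. unfold z. simpl. ring. }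
  rewrite Eu in Ec.
  assert (B : Re (Cconj z * derive01 f c)%C <= Cmod z * K).
  { eapply Rle_trans; [apply Rle_abs|].
    eapply Rle_trans; [apply Rmax_l|].
    eapply Rle_trans; [apply Rmax_Cmod|].
    rewrite Cmod_mult, Cmod_conj. apply Rmult_le_compat_l; [apply Cmod_ge_0|now apply HK]. }
  pose proof (Cmod_ge_0 z) as Z0.
  assert (K0 : 0 <= K).
  { eapply Rle_trans; [apply Cmod_ge_0|apply (HK 0); lra]. }
  destruct (Req_dec (Cmod z) 0) as [Ez|Ez].
  + rewrite Ez. apply Rmult_le_pos; lra.
  + apply Rmult_le_reg_l with (Cmod z); [lra|].
    apply Rmult_le_compat_r with (r := x) in B; [|lra]. nra.
Qed.

Lemma flat_order (n : nat) : forall (f : R -> C) (B : R), flat f ->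
  (forall x, I01 x -> Cmod (derive01_n n f x) <= B) ->
  forall x, I01 x -> Cmod (f x) <= x ^ n * B.
Proof.
induction n as [|n IH]; intros f B Hf HB x Hx.
- rewrite pow_O, Rmult_1_l. now apply HB.
- assert (H := IH (derive01 f) B (flat_derive f Hf)).
  assert (B0 : 0 <= B) by (eapply Rle_trans; [apply Cmod_ge_0|now apply (HB x)]).
  replace (f x) with (f x - f 0)%C by (rewrite (proj1 (Hf O)); ring).
  replace (x ^ S n * B) with ((x ^ n * B) * x) by (simpl; ring).
  apply mvt01; [easy|apply (Hf 1%nat)|].
  intros t Ht. unfold I01 in Hx.
  eapply Rle_trans.
  + apply H; [|unfold I01; lra]. intros y Hy. rewrite <- derive01_n_S. now apply HB.
  + apply Rmult_le_compat_r; [easy|]. now apply pow_incr.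
Qed.

Lemma Rpower_pow_le (p : R) (k n : nat) (x : R) : 0 < x <= 1 -> INR k <= INR n + p ->
  Rpower x p * x ^ n <= x ^ k.
Proof.
intros Hx H. rewrite <- !Rpower_pow by lra. rewrite <- Rpower_plus.
unfold Rpower.
assert (L : ln x <= 0).
{ rewrite <- ln_1. destruct (Req_dec x 1) as [->|]; [lra|]. left. apply ln_increasing; lra. }
destruct (Rle_lt_or_eq_dec ((p + INR n) * ln x) (INR k * ln x)) as [Q|Q].
- nra.
- left. now apply exp_increasing.
- rewrite Q. lra.
Qed.

Lemma exists_INR_ge (r : R) : exists n, r <= INR n.
Proof.
exists (Z.to_nat (up r)). destruct (archimed r) as [H _].
rewrite INR_IZR_INZ. destruct (Z.le_gt_cases 0 (up r)) as [G|G].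
- rewrite Z2Nat.id by easy. lra.
- assert (E : (up r <= 0)%Z) by lia. apply IZR_le in E.
  assert (0 <= IZR (Z.of_nat (Z.to_nat (up r)))) by (apply IZR_le; lia). lra.
Qed.

Lemma power_fun_order (p : R) (k n : nat) (f : R -> C) (B : R) : flat f ->
  INR k <= INR n + p ->
  (forall x, I01 x -> Cmod (derive01_n n f x) <= B) ->
  forall x, I01 x -> Cmod (power_fun p f x) <= x ^ k * B.
Proof.
intros Hf Hk HB x Hx.
assert (B0 : 0 <= B) by (eapply Rle_trans; [apply Cmod_ge_0|now apply (HB x)]).
unfold I01 in Hx. unfold power_fun. destruct (Rlt_dec 0 x) as [P|P].
- rewrite Cmod_mult, Cmod_R.
  assert (0 < Rpower x p) by apply exp_pos.
  rewrite Rabs_pos_eq by lra.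
  eapply Rle_trans.
  + apply Rmult_le_compat_l; [lra|]. now apply (flat_order n f B).
  + rewrite <- Rmult_assoc. apply Rmult_le_compat_r; [easy|].
    apply Rpower_pow_le; [lra|easy].
- rewrite Cmod_0. apply Rmult_le_pos; [|easy]. apply pow_le; lra.
Qed.

Lemma power_fun_is_derive01 (p : R) (f : R -> C) (x : R) : flat f -> I01 x ->
  is_derive01 (power_fun p f) x
    (RtoC p * power_fun (p - 1) f x + power_fun p (derive01 f) x)%C.
Proof.
intros Hf Hx. destruct (Rlt_dec 0 x) as [P|P].
- apply is_derive01_ext_loc with (fun y => RtoC (Rpower y p) * f y)%C (mkposreal x P).
  + easy.
  + simpl. intros y _ Hy. unfold power_fun. apply Rabs_def2 in Hy.
    destruct (Rlt_dec 0 y); [easy|lra].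
  + unfold power_fun. destruct (Rlt_dec 0 x); [|easy].
    replace (RtoC p * (RtoC (Rpower x (p - 1)) * f x) + RtoC (Rpower x p) * derive01 f x)%C
      with (RtoC (p * Rpower x (p - 1)) * f x + RtoC (Rpower x p) * derive01 f x)%C
      by (rewrite RtoC_mult; ring).
    apply (is_derive01_scal_real (fun y => Rpower y p)); [easy| |now apply flat_diff].
    apply (is_derive_Reals (fun y => Rpower y p)). exact (derivable_pt_lim_power x p P).
- assert (x = 0) as -> by (unfold I01 in Hx; lra).
  assert (Z : forall q g, power_fun q g 0 = 0%C).
  { intros q g. unfold power_fun. destruct (Rlt_dec 0 0); [lra|easy]. }
  rewrite 2!Z. replace (RtoC p * 0 + 0)%C with (RtoC 0) by ring.
  apply is_derive01_eps; [easy|]. intros eps.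
  destruct (exists_INR_ge (2 - p)) as [n Hn].
  destruct (derive01_bounded (derive01_n n f) (proj1 (proj2 (proj2 (flat_derive_n f n Hf 1%nat)))))
    as [B HB].
  assert (B0 : 0 <= B) by (eapply Rle_trans; [apply Cmod_ge_0|now apply (HB 0)]).
  assert (Q : 0 < eps / (B + 1)) by (apply Rdiv_lt_0_compat; [apply eps|lra]).
  exists (mkposreal _ Q). simpl. intros y Hy Hy'.
  rewrite Z. replace (power_fun p f y - 0 - RtoC (y - 0) * 0)%C with (power_fun p f y) by ring.
  rewrite Rminus_0_r in *. unfold I01 in Hy. rewrite Rabs_pos_eq in * by lra.
  eapply Rle_trans.
  + apply (power_fun_order p 2 n f B Hf); [simpl; lra|exact HB|exact Hy].
  + assert (E : (B + 1) * (eps / (B + 1)) = eps) by (field; lra).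
    assert (y * B <= eps) by nra.
    replace (y ^ 2 * B) with ((y * B) * y) by ring.
    apply Rmult_le_compat_r; lra.
Qed.

Lemma power_fun_outside (p : R) (f : R -> C) (x : R) : flat f -> ~ I01 x ->
  power_fun p f x = 0%C.
Proof.
intros Hf Hx. unfold power_fun. destruct (Rlt_dec 0 x); [|easy].
rewrite (proj1 (proj2 (Hf O))) by easy. ring.
Qed.

Lemma derive01_power_fun (p : R) (f : R -> C) : flat f ->
  derive01 (power_fun p f) =
  (fun x => RtoC p * power_fun (p - 1) f x + power_fun p (derive01 f) x)%C.
Proof.
intros Hf. apply functional_extensionality. intros x.
destruct (I01_dec x) as [Hx|Hx].
- apply derive01_unique; [easy|]. now apply power_fun_is_derive01.
- rewrite derive01_outside, !power_fun_outside by (try apply flat_derive; easy). ring.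
Qed.

Lemma power_fun_flat_n (n : nat) : forall (p : R) (f : R -> C),
  flat f -> flat_n n (power_fun p f).
Proof.
assert (Z : forall q g, power_fun q g 0 = 0%C).
{ intros q g. unfold power_fun. destruct (Rlt_dec 0 0); [lra|easy]. }
induction n as [|n IH]; intros p f Hf; simpl.
- split; [apply Z|]. split; [|easy]. intros x. now apply power_fun_outside.
- split; [apply Z|]. split; [intros x; now apply power_fun_outside|]. split.
  + intros x Hx. eexists. now apply power_fun_is_derive01.
  + rewrite derive01_power_fun by easy.
    apply flat_n_plus; [apply flat_n_scal|]; apply IH; [easy|now apply flat_derive].
Qed.

Lemma power_fun_flat (p : R) (f : R -> C) : flat f -> flat (power_fun p f).
Proof. intros Hf n. now apply power_fun_flat_n. Qed.

Definition power_mult (p : R) (f : C0inf) : C0inf :=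
  flat_C0inf (power_fun p f) (power_fun_flat p f (C0inf_flat f)).

Lemma power_mult_plus (p : R) (f g : c0_lcs) :
  power_mult p (plus f g) = plus (power_mult p f) (power_mult p g) :> c0_lcs.
Proof.
apply c0_ext. intros x. simpl. unfold power_fun. destruct (Rlt_dec 0 x); ring.
Qed.

Lemma power_mult_scal (p : R) (a : C) (f : c0_lcs) :
  power_mult p (scal (a : C_Ring) f) = scal (a : C_Ring) (power_mult p f) :> c0_lcs.
Proof.
apply c0_ext. intros x. simpl. unfold power_fun. destruct (Rlt_dec 0 x); ring.
Qed.

Lemma power_fun_bounded (n : nat) : forall p, exists m K, 0 <= K /\
  forall (f : C0inf) x, I01 x ->
    Cmod (derive01_n n (power_fun p f) x) <= K * c0_norm m f.
Proof.
induction n as [|n IH]; intros p.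
- destruct (exists_INR_ge (- p)) as [m Hm].
  exists m, 1. split; [lra|]. intros f x Hx.
  replace (1 * c0_norm m f) with (x ^ 0 * c0_norm m f) by (simpl; ring).
  apply (power_fun_order p 0 m f); [apply C0inf_flat|simpl; lra| |easy].
  intros y Hy. now apply c0_norm_ge.
- destruct (IH (p - 1)) as [m1 [K1 [P1 H1]]], (IH p) as [m2 [K2 [P2 H2]]].
  exists (Nat.max m1 (S m2)), (Rabs p * K1 + K2). split.
  { pose proof (Rabs_pos p). nra. }
  intros f x Hx.
  pose proof (C0inf_flat f) as Hf.
  rewrite derive01_n_S, derive01_power_fun by easy.
  rewrite (derive01_n_plus n (fun x => RtoC p * power_fun (p - 1) f x)%C)
    by (try apply flat_scal; apply power_fun_flat; try apply flat_derive; easy).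
  rewrite derive01_n_scal by now apply power_fun_flat.
  eapply Rle_trans; [apply Cmod_triangle|].
  rewrite Cmod_mult, Cmod_R, Rmult_plus_distr_r. apply Rplus_le_compat.
  + rewrite Rmult_assoc. apply Rmult_le_compat_l; [apply Rabs_pos|].
    eapply Rle_trans; [now apply H1|].
    apply Rmult_le_compat_l; [easy|]. apply c0_norm_mono. lia.
  + eapply Rle_trans; [now apply (H2 (c0_derive f))|].
    apply Rmult_le_compat_l; [easy|].
    eapply Rle_trans; [apply c0_norm_derive|]. apply c0_norm_mono. lia.
Qed.

Lemma power_mult_bounded (p : R) (n : nat) : exists m K, 0 <= K /\
  forall f : C0inf, c0_norm n (power_mult p f) <= K * c0_norm m f.
Proof.
assert (A : exists m K, 0 <= K /\ forall (f : C0inf) j x, (j <= n)%nat -> I01 x ->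
   Cmod (derive01_n j (power_fun p f) x) <= K * c0_norm m f).
{ induction n as [|n [m [K [PK IH]]]].
  - destruct (power_fun_bounded 0 p) as [m [K [PK H]]].
    exists m, K. split; [easy|]. intros f j x Hj. replace j with O by lia. apply H.
  - destruct (power_fun_bounded (S n) p) as [m' [K' [PK' H]]].
    exists (Nat.max m m'), (Rmax K K'). split.
    { eapply Rle_trans; [exact PK|apply Rmax_l]. }
    intros f j x Hj Hx. destruct (Nat.eq_dec j (S n)) as [->|E].
    + eapply Rle_trans; [now apply H|]. apply Rmult_le_compat; [easy|apply c0_norm_ge_0|apply Rmax_r|].
      apply c0_norm_mono. lia.
    + eapply Rle_trans; [apply IH; [lia|easy]|].
      apply Rmult_le_compat; [easy|apply c0_norm_ge_0|apply Rmax_l|].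
      apply c0_norm_mono. lia. }
destruct A as [m [K [PK H]]]. exists m, K. split; [easy|].
intros f. apply c0_norm_le. intros j x Hj Hx. now apply H.
Qed.

Definition power_op (p : R) : clin c0_lcs :=
  @Clin c0_lcs (power_mult p) (power_mult_plus p) (power_mult_scal p)
    (lcs_bounded_continuous c0_lcs (power_mult p)
       (power_mult_plus p) (power_mult_scal p) (power_mult_bounded p)).

(* Main.v *)
Require Import Defs.
From Stdlib Require Import Reals Lra Lia List FunctionalExtensionality Description.
From Coquelicot Require Import Coquelicot.
Open Scope R_scope.

(** With (u, h) = (V f, g), respectively (u, h) = (f, g'), the equation
    lambda f - T f = g becomes lambda u' - x^p u = h on C_0^inf. With W' = x^p and
    a = 1/lambda, the integrating factor exp (a W) gives the only candidate
    u(x) = a * int_0^x exp (a (W(x) - W(t))) h(t) dt. If p >= -1 the kernel is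
    O(t^(-|a|)), and if Re a <= 0 it is bounded by 1; as h is flat at 0, u then decays
    faster than every power of x, and the equation propagates this to all
    derivatives, with bounds that are locally uniform in lambda. If p < -1 and
    Re a > 0, exp (a W) is itself flat at 0 and is an eigenfunction. If p >= -1, the
    resolvents are not equicontinuous at 0: for lambda > 0 and h = e' >= 0 with
    e(1) = 1, positivity of the kernel gives u(1) >= 1/lambda. *)

(** * The integrating factor *)

(** The antiderivative of [x^p] on x > 0 that vanishes at 1. *)
Definition power_primitive (p x : R) : R :=
  if Req_EM_T p (-1) then ln x else (Rpower x (p + 1) - 1) / (p + 1).

Lemma power_primitive_1 (p : R) : power_primitive p 1 = 0.
Proof.
unfold power_primitive. destruct (Req_EM_T p (-1)); [apply ln_1|].
unfold Rpower. rewrite ln_1, Rmult_0_r, exp_0. field. lra.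
Qed.

Lemma is_derive_power_primitive (p x : R) : 0 < x ->
  is_derive (power_primitive p) x (Rpower x p).
Proof.
intros Hx. unfold power_primitive. destruct (Req_EM_T p (-1)) as [->|Hp].
- replace (Rpower x (-1)) with (/ x).
  + now apply is_derive_Reals, derivable_pt_lim_ln.
  + replace (-1) with (- (1)) by ring. now rewrite Rpower_Ropp, Rpower_1.
- apply (is_derive_ext (fun y => / (p + 1) * (Rpower y (p + 1) - 1))).
  { intros y. unfold Rdiv. apply Rmult_comm. }
  replace (Rpower x p) with (/ (p + 1) * ((p + 1) * Rpower x (p + 1 - 1) - 0)).
  + apply (is_derive_scal (fun y => Rpower y (p + 1) - 1)).
    apply (is_derive_minus (fun y => Rpower y (p + 1))).
    * apply is_derive_Reals. now apply derivable_pt_lim_power.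
    * apply (is_derive_const (K := R_AbsRing) (V := R_NormedModule)).
  + replace (p + 1 - 1) with p by ring. field. lra.
Qed.

(** Mean value theorem for [g - f], whose derivative is nonnegative. *)
Lemma increment_le (f g df dg : R -> R) (a b : R) : a <= b ->
  (forall x, a <= x <= b -> is_derive f x (df x)) ->
  (forall x, a <= x <= b -> is_derive g x (dg x)) ->
  (forall x, a <= x <= b -> df x <= dg x) ->
  f b - f a <= g b - g a.
Proof.
intros Hab Hf Hg H.
assert (D : forall x, a <= x <= b -> is_derive (fun y => g y - f y) x (dg x - df x)).
{ intros x Hx. apply (is_derive_minus (V := R_NormedModule) g f); [now apply Hg|now apply Hf]. }
destruct (MVT_gen (fun y => g y - f y) a b (fun x => dg x - df x)) as [c [Hc E]].
- rewrite Rmin_left, Rmax_right by easy. intros x Hx. apply D. lra.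
- rewrite Rmin_left, Rmax_right by easy. intros x Hx.
  apply derivable_continuous_pt. eexists. apply is_derive_Reals. now apply D.
- rewrite Rmin_left, Rmax_right in Hc by easy. specialize (H c Hc).
  assert (0 <= (dg c - df c) * (b - a)) by (apply Rmult_le_pos; lra). lra.
Qed.

Lemma power_primitive_incr (p t x : R) : 0 < t <= x ->
  power_primitive p t <= power_primitive p x.
Proof.
intros H.
enough (0 - 0 <= power_primitive p x - power_primitive p t) by lra.
apply (increment_le (fun _ => 0) (power_primitive p) (fun _ => 0) (fun y => Rpower y p));
  [lra| | |].
- intros y _. apply (is_derive_const (K := R_AbsRing) (V := R_NormedModule)).
- intros y Hy. apply is_derive_power_primitive. lra.
- intros y _. left. apply exp_pos.
Qed.

(** For p >= -1, x^p <= 1/x on (0,1], so W grows no faster than [ln], and [ln x] <= 0. This is where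
    the threshold p = -1 enters. *)
Lemma power_primitive_le_ln (p t x : R) : -1 <= p -> 0 < t <= x -> x <= 1 ->
  power_primitive p x - power_primitive p t <= - ln t.
Proof.
intros Hp H Hx.
assert (L : forall y, 0 < y <= 1 -> ln y <= 0).
{ intros y Hy. rewrite <- ln_1. apply ln_le; lra. }
enough (power_primitive p x - power_primitive p t <= ln x - ln t)
  by (specialize (L x ltac:(lra)); lra).
apply (increment_le _ ln (fun y => Rpower y p) (fun y => / y)); [lra| | |].
- intros y Hy. apply is_derive_power_primitive. lra.
- intros y Hy. apply is_derive_Reals, derivable_pt_lim_ln. lra.
- intros y Hy. replace (/ y) with (exp (- ln y)) by (rewrite exp_Ropp, exp_ln; lra).
  unfold Rpower. specialize (L y ltac:(lra)).
  destruct (Rle_lt_or_eq_dec (p * ln y) (- ln y)) as [Q|Q]; [nra| |rewrite Q; lra].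
  left. now apply exp_increasing.
Qed.

(** [exp (a W(x))], where W is [power_primitive p]. *)
Definition int_factor (p : R) (a : C) (x : R) : C :=
  (exp (Re a * power_primitive p x) * cos (Im a * power_primitive p x),
   exp (Re a * power_primitive p x) * sin (Im a * power_primitive p x)).

Lemma Cmod_int_factor (p : R) (a : C) (x : R) :
  Cmod (int_factor p a x) = exp (Re a * power_primitive p x).
Proof.
unfold int_factor, Cmod. simpl fst; simpl snd.
set (e := exp _). set (y := Im a * _).
replace ((e * cos y) ^ 2 + (e * sin y) ^ 2) with (e ^ 2).
- apply sqrt_pow2. left. apply exp_pos.
- pose proof (sin2_cos2 y) as H. unfold Rsqr in H.
  replace ((e * cos y) ^ 2 + (e * sin y) ^ 2) with (e ^ 2 * (sin y * sin y + cos y * cos y))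
    by ring. rewrite H. ring.
Qed.

Lemma int_factor_opp (p : R) (a : C) (x : R) :
  (int_factor p a x * int_factor p (- a)%C x)%C = 1%C.
Proof.
unfold int_factor. simpl Re; simpl Im.
set (W := power_primitive p x).
rewrite <- !Ropp_mult_distr_l, exp_Ropp, cos_neg, sin_neg.
set (e := exp _). assert (P : 0 < e) by apply exp_pos.
pose proof (sin2_cos2 (Im a * W)) as H. unfold Rsqr in H.
unfold Cmult, RtoC. simpl. fold (Im a). f_equal; [|field; lra].
rewrite <- H. field. lra.
Qed.

Lemma int_factor_1 (p : R) (a : C) : int_factor p a 1 = 1%C.
Proof.
unfold int_factor. rewrite power_primitive_1, !Rmult_0_r, exp_0, cos_0, sin_0, !Rmult_1_l.
easy.
Qed.

(** Writing the factor as [c + Ci * s] with [c] and [s] real reduces the claim to the product rule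
    for a real factor. *)
Lemma int_factor_is_derive01 (p : R) (a : C) (f : R -> C) (x : R) (l : C) : 0 < x <= 1 ->
  is_derive01 f x l ->
  is_derive01 (fun y => int_factor p a y * f y)%C x
    (a * RtoC (Rpower x p) * (int_factor p a x * f x) + int_factor p a x * l)%C.
Proof.
intros Hx Hf. assert (Ix : I01 x) by (unfold I01; lra).
set (W := power_primitive p).
assert (HW : is_derive W x (Rpower x p)) by (apply is_derive_power_primitive; lra).
set (c := fun t => exp (Re a * t) * cos (Im a * t)).
set (s := fun t => exp (Re a * t) * sin (Im a * t)).
assert (Hc : is_derive (fun y => c (W y)) x (Rpower x p * (Re a * c (W x) - Im a * s (W x)))).
{ apply (is_derive_comp c W); [|easy]. unfold c, s. auto_derive; [easy|ring]. }
assert (Hs : is_derive (fun y => s (W y)) x (Rpower x p * (Re a * s (W x) + Im a * c (W x)))).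
{ apply (is_derive_comp s W); [|easy]. unfold c, s. auto_derive; [easy|ring]. }
pose proof (is_derive01_scal_real _ _ _ _ _ Ix Hc Hf) as H1.
pose proof (is_derive01_scal Ci _ _ _ Ix (is_derive01_scal_real _ _ _ _ _ Ix Hs Hf)) as H2.
pose proof (is_derive01_plus _ _ _ _ _ H1 H2) as H.
assert (E : forall y, int_factor p a y = (RtoC (c (W y)) + Ci * RtoC (s (W y)))%C).
{ intros y. unfold int_factor, c, s, W, Ci, RtoC, Cplus, Cmult. simpl. f_equal; ring. }
refine (is_derive01_ext_loc _ _ x _ (mkposreal 1 Rlt_0_1) Ix _
  (eq_ind _ (is_derive01 _ x) H _ _)).
- intros y _ _. rewrite E. ring.
- rewrite E, !RtoC_mult, RtoC_minus, RtoC_plus, !RtoC_mult.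
  replace a with (RtoC (Re a) + Ci * RtoC (Im a))%C at 5.
  + assert (I2 : (Ci * Ci = - (1))%C).
    { unfold Ci, Cmult, Copp, RtoC. simpl. f_equal; ring. }
    ring [I2].
  + destruct a as [u v]. unfold Ci, RtoC, Cplus, Cmult. simpl. f_equal; ring.
Qed.

(** * Flatness from rapid decay *)

(** Only values are controlled, not derivatives; for solutions of the differential equation,
    [ode_flat] upgrades this to flatness. *)
Definition rapid_decay (u : R -> C) : Prop :=
  forall k, exists B, forall x, I01 x -> Cmod (u x) <= x ^ k * B.

Lemma flat_rapid_decay (f : R -> C) : flat f -> rapid_decay f.
Proof.
intros Hf k.
destruct (derive01_bounded (derive01_n k f)) as [B HB].
- apply (proj1 (proj2 (proj2 (flat_derive_n f k Hf 1%nat)))).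
- exists B. now apply flat_order.
Qed.

(** The bound O(y^2) already makes the difference quotient at 0 tend to 0. *)
Lemma is_derive01_0_of_decay (u : R -> C) : u 0 = 0%C -> rapid_decay u ->
  is_derive01 u 0 0%C.
Proof.
intros U0 Hu. assert (I0 : I01 0) by (unfold I01; lra).
apply is_derive01_eps; [easy|]. intros eps.
destruct (Hu 2%nat) as [B HB].
assert (P : 0 < Rabs B + 1) by (pose proof (Rabs_pos B); lra).
assert (Q : 0 < eps / (Rabs B + 1)) by (apply Rdiv_lt_0_compat; [apply eps|lra]).
exists (mkposreal _ Q). simpl. intros y Hy Hy'.
rewrite U0. replace (u y - 0 - RtoC (y - 0) * 0)%C with (u y) by ring.
rewrite Rminus_0_r in *. unfold I01 in Hy. rewrite Rabs_pos_eq in * by lra.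
eapply Rle_trans; [now apply HB|].
replace (y ^ 2 * B) with (y * B * y) by ring.
apply Rmult_le_compat_r; [lra|].
assert (E : (Rabs B + 1) * (eps / (Rabs B + 1)) = eps) by (field; lra).
pose proof (Rle_abs B). nra.
Qed.

Lemma power_fun_le_0 (p : R) (u : R -> C) (x : R) : x <= 0 -> power_fun p u x = 0%C.
Proof. intros Hx. unfold power_fun. destruct (Rlt_dec 0 x); [lra|easy]. Qed.

Lemma power_fun_pos (p : R) (u : R -> C) (x : R) : 0 < x ->
  power_fun p u x = (RtoC (Rpower x p) * u x)%C.
Proof. intros Hx. unfold power_fun. destruct (Rlt_dec 0 x); [easy|lra]. Qed.

Lemma power_fun_decay (p : R) (u : R -> C) : rapid_decay u -> rapid_decay (power_fun p u).
Proof.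
(* Decay of order n >= k - p leaves order k after multiplication by x^p. *)
intros Hu k. destruct (exists_INR_ge (INR k - p)) as [n Hn].
destruct (Hu n) as [B HB]. exists (Rabs B). intros x Hx.
pose proof (Rabs_pos B). unfold I01 in Hx.
destruct (Rlt_dec 0 x) as [P|P].
- rewrite power_fun_pos, Cmod_mult, Cmod_R by easy.
  assert (0 < Rpower x p) by apply exp_pos. rewrite Rabs_pos_eq by lra.
  apply Rle_trans with (Rpower x p * (x ^ n * Rabs B)).
  + apply Rmult_le_compat_l; [lra|]. eapply Rle_trans; [now apply HB|].
    apply Rmult_le_compat_l; [apply pow_le; lra|apply Rle_abs].
  + rewrite <- Rmult_assoc. apply Rmult_le_compat_r; [easy|].
    apply Rpower_pow_le; lra.
- rewrite power_fun_le_0, Cmod_0 by lra. apply Rmult_le_pos; [apply pow_le; lra|easy].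
Qed.

Lemma power_fun_comp (p q : R) (u : R -> C) (x : R) :
  power_fun q (power_fun p u) x = power_fun (p + q) u x.
Proof.
unfold power_fun. destruct (Rlt_dec 0 x); [|easy].
rewrite Rpower_plus, RtoC_mult. ring.
Qed.

(** The induction needs all powers at once: differentiating [x^q u] produces
    [x^(q-1) u] and [x^(p+q) u]. *)
Lemma ode_flat_n (n : nat) (p : R) (a : C) (u g : R -> C) :
  flat g -> u 0 = 0%C -> (forall x, ~ I01 x -> u x = 0%C) -> rapid_decay u ->
  (forall x, 0 < x <= 1 -> is_derive01 u x (a * power_fun p u x + g x)%C) ->
  forall q, flat_n n (power_fun q u).
Proof.
intros Hg U0 Uout Hu ODE.
assert (PO : forall q x, ~ I01 x -> power_fun q u x = 0%C).
{ intros q x Hx. unfold power_fun. destruct (Rlt_dec 0 x); [|easy].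
  rewrite Uout by easy. ring. }
assert (P0 : forall q v, power_fun q v 0 = 0%C) by (intros; apply power_fun_le_0; lra).
assert (D : forall q x, I01 x -> is_derive01 (power_fun q u) x
   (RtoC q * power_fun (q - 1) u x + (a * power_fun (p + q) u x + power_fun q g x))%C).
{ intros q x Hx. destruct (Rlt_dec 0 x) as [Px|Px].
  - refine (is_derive01_ext_loc (fun y => RtoC (Rpower y q) * u y)%C _ x _
      (mkposreal x Px) Hx _ (eq_ind _ (is_derive01 _ x) _ _ _)).
    + simpl. intros y _ Hy. apply Rabs_def2 in Hy. rewrite power_fun_pos; [easy|lra].
    + apply (is_derive01_scal_real (fun y => Rpower y q) (q * Rpower x (q - 1))); [easy| |].
      * apply is_derive_Reals. now apply derivable_pt_lim_power.
      * apply ODE. unfold I01 in Hx. lra.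
    + rewrite <- power_fun_comp, !power_fun_pos by easy.
      rewrite RtoC_mult. ring.
  (* At 0 the claimed derivative is 0, which follows from the decay of x^q u. *)
  - assert (x = 0) as -> by (unfold I01 in Hx; lra).
    rewrite !P0. replace (RtoC q * 0 + (a * 0 + 0))%C with (RtoC 0) by ring.
    apply is_derive01_0_of_decay; [apply P0|now apply power_fun_decay]. }
induction n as [|n IH]; intros q; simpl.
- split; [apply P0|]. split; [apply PO|easy].
- split; [apply P0|]. split; [apply PO|]. split.
  + intros x Hx. eexists. now apply D.
  + assert (E : derive01 (power_fun q u) = (fun x =>
      RtoC q * power_fun (q - 1) u x + (a * power_fun (p + q) u x + power_fun q g x))%C).
    { apply functional_extensionality. intros x. destruct (I01_dec x) as [Hx|Hx].
      - apply derive01_unique; auto.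
      - rewrite derive01_outside, !PO, power_fun_outside by easy. ring. }
    rewrite E. apply flat_n_plus; [now apply flat_n_scal|].
    apply flat_n_plus; [now apply flat_n_scal|]. now apply power_fun_flat.
Qed.

(** The case [q = 0]: x^0 u is u itself, because u vanishes for x <= 0. *)
Lemma ode_flat (p : R) (a : C) (u g : R -> C) :
  flat g -> u 0 = 0%C -> (forall x, ~ I01 x -> u x = 0%C) -> rapid_decay u ->
  (forall x, 0 < x <= 1 -> is_derive01 u x (a * power_fun p u x + g x)%C) ->
  flat u.
Proof.
intros Hg U0 Uout Hu ODE n.
replace u with (power_fun 0 u).
- now apply (ode_flat_n n p a u g).
- apply functional_extensionality. intros x.
  destruct (Rlt_dec 0 x) as [Px|Px].
  + rewrite power_fun_pos, Rpower_O by easy. ring.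
  + rewrite power_fun_le_0 by lra. symmetry.
    destruct (Req_dec x 0) as [->|Nx]; [easy|]. apply Uout. unfold I01. lra.
Qed.

(** * Decay of solutions of u' = a x^p u + g *)

(** [exp (a (W(x) - W(t)))], the kernel of the solution formula, is at most [t^(-N)]. *)
Definition kernel_bound (p : R) (a : C) (N : nat) : Prop :=
  forall t x, 0 < t <= x -> x <= 1 ->
    Cmod (int_factor p a x) * Cmod (int_factor p (- a)%C t) * t ^ N <= 1.

Lemma exp_incr (x y : R) : x <= y -> exp x <= exp y.
Proof. intros [H|E]; [left; now apply exp_increasing|rewrite E; lra]. Qed.

(** W is increasing, so the exponent Re a (W(x) - W(t)) is nonpositive. *)
Lemma kernel_bound_npos (p : R) (a : C) : Re a <= 0 -> kernel_bound p a 0.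
Proof.
intros Ha t x Htx Hx. rewrite !Cmod_int_factor, <- exp_plus, pow_O, Rmult_1_r, <- exp_0.
pose proof (power_primitive_incr p t x Htx).
apply exp_incr. change (Re (- a)%C) with (- Re a). nra.
Qed.

Lemma Re_le_Cmod (z : C) : Rabs (Re z) <= Cmod z.
Proof. eapply Rle_trans; [apply Rmax_l|apply Rmax_Cmod]. Qed.

(** Since 0 <= W(x) - W(t) <= -ln t, the exponent is at most -N ln t, which t^N cancels. *)
Lemma kernel_bound_ge (p : R) (a : C) (N : nat) : -1 <= p -> Cmod a <= INR N ->
  kernel_bound p a N.
Proof.
intros Hp Ha t x Htx Hx.
rewrite !Cmod_int_factor, <- Rpower_pow by lra. unfold Rpower.
rewrite <- !exp_plus, <- exp_0. apply exp_incr.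
pose proof (power_primitive_incr p t x Htx).
pose proof (power_primitive_le_ln p t x Hp Htx Hx).
pose proof (Rle_trans _ _ _ (Rle_abs (Re a)) (Re_le_Cmod a)).
change (Re (- a)%C) with (- Re a). pose proof (pos_INR N). nra.
Qed.

Lemma int_factor_kernel_bound (p : R) (a : C) (N : nat) (t : R) : kernel_bound p a N ->
  0 < t <= 1 -> Cmod (int_factor p (- a)%C t) * t ^ N <= 1.
Proof.
intros H Ht. specialize (H t 1 Ht (Rle_refl 1)).
now rewrite int_factor_1, Cmod_1, Rmult_1_l in H.
Qed.

(** The product exp(a W) f, set to 0 for x <= 0, where W has no meaning. *)
Definition int_mult (p : R) (a : C) (f : R -> C) (x : R) : C :=
  if Rlt_dec 0 x then (int_factor p a x * f x)%C else 0%C.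

Lemma int_mult_pos (p : R) (a : C) (f : R -> C) (x : R) : 0 < x ->
  int_mult p a f x = (int_factor p a x * f x)%C.
Proof. intros Hx. unfold int_mult. destruct (Rlt_dec 0 x); [easy|lra]. Qed.

Lemma int_mult_le_0 (p : R) (a : C) (f : R -> C) (x : R) : x <= 0 ->
  int_mult p a f x = 0%C.
Proof. intros Hx. unfold int_mult. destruct (Rlt_dec 0 x); [lra|easy]. Qed.

(** The factor exp(-a W) costs at most N powers of x, so order k is obtained from order N + k of
    f. *)
Lemma int_mult_decay (p : R) (a : C) (N : nat) (f : R -> C) : kernel_bound p a N ->
  flat f -> rapid_decay (int_mult p (- a)%C f).
Proof.
intros HN Hf k. destruct (flat_rapid_decay f Hf (N + k)%nat) as [B HB].
exists (Rabs B). intros x Hx. pose proof (Rabs_pos B). unfold I01 in Hx.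
assert (0 <= x ^ k * Rabs B) by (apply Rmult_le_pos; [apply pow_le; lra|easy]).
destruct (Rlt_dec 0 x) as [Px|Px].
- rewrite int_mult_pos, Cmod_mult by easy.
  apply Rle_trans with (Cmod (int_factor p (- a)%C x) * (x ^ (N + k) * Rabs B)).
  + apply Rmult_le_compat_l; [apply Cmod_ge_0|]. eapply Rle_trans; [now apply HB|].
    apply Rmult_le_compat_l; [apply pow_le; lra|apply Rle_abs].
  + replace (Cmod (int_factor p (- a)%C x) * (x ^ (N + k) * Rabs B)) with
      (Cmod (int_factor p (- a)%C x) * x ^ N * (x ^ k * Rabs B)) by (rewrite pow_add; ring).
    rewrite <- (Rmult_1_l (x ^ k * Rabs B)) at 2. apply Rmult_le_compat_r; [easy|].
    apply int_factor_kernel_bound; [easy|lra].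
- rewrite int_mult_le_0, Cmod_0 by lra. easy.
Qed.

Lemma int_mult_is_derive01 (p : R) (a : C) (f : R -> C) (x : R) (l : C) : 0 < x <= 1 ->
  is_derive01 f x l ->
  is_derive01 (int_mult p a f) x
    (a * power_fun p (int_mult p a f) x + int_factor p a x * l)%C.
Proof.
intros Hx Hf.
refine (is_derive01_ext_loc _ _ x _ (mkposreal x (proj1 Hx)) _ _
  (eq_ind _ (is_derive01 _ x) (int_factor_is_derive01 p a f x l Hx Hf) _ _)).
- unfold I01. lra.
- simpl. intros y _ Hy. apply Rabs_def2 in Hy. rewrite int_mult_pos; [easy|lra].
- rewrite power_fun_pos, int_mult_pos by easy. ring.
Qed.

(** For flat f the product rule for exp(-a W) f extends to x = 0, where decay makes both sides
    vanish. *)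
Lemma int_mult_flat_is_derive01 (p : R) (a : C) (N : nat) (f : R -> C) (x : R) :
  kernel_bound p a N -> flat f -> I01 x ->
  is_derive01 (int_mult p (- a)%C f) x
    (- a * power_fun p (int_mult p (- a)%C f) x + int_mult p (- a)%C (derive01 f) x)%C.
Proof.
intros HN Hf Hx. destruct (Rlt_dec 0 x) as [Px|Px].
- rewrite (int_mult_pos p (- a)%C (derive01 f)) by easy.
  apply int_mult_is_derive01; [unfold I01 in Hx; lra|now apply flat_diff].
- assert (x = 0) as -> by (unfold I01 in Hx; lra).
  rewrite power_fun_le_0, int_mult_le_0 by lra.
  replace (- a * 0 + 0)%C with (RtoC 0) by ring.
  apply is_derive01_0_of_decay; [apply int_mult_le_0; lra|now apply int_mult_decay with N].
Qed.

(** Here u = [int_factor p a * v] is the solution of u' = a x^p u + g. *)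
Lemma solution_bound (p : R) (a : C) (N : nat) (g : C0inf) (v : R -> C) :
  kernel_bound p a N -> v 0 = 0%C ->
  (forall x, I01 x -> is_derive01 v x (int_mult p (- a)%C g x)) ->
  forall k x, 0 < x <= 1 -> Cmod (int_factor p a x * v x)%C <= x ^ k * c0_norm (N + k) g.
Proof.
intros HN V0 Hv k x Hx.
set (G := c0_norm (N + k) g).
assert (G0 : 0 <= G) by apply c0_norm_ge_0.
assert (P : 0 < Cmod (int_factor p a x)) by (rewrite Cmod_int_factor; apply exp_pos).
set (e := Cmod (int_factor p a x)) in *.
assert (X0 : 0 <= x ^ k * G) by (apply Rmult_le_pos; [apply pow_le; lra|easy]).
(* Mean value inequality on [0,x]; the bound on v' carries 1/[e], to be cancelled by the factor
   exp(a W(x)) of u. *)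
assert (H : Cmod (v x - v 0)%C <= / e * (x ^ k * G) * x).
{ apply mvt01; [unfold I01; lra|intros y Hy; eexists; now apply Hv|].
  intros t Ht. assert (It : I01 t) by (unfold I01; lra).
  rewrite (derive01_unique v t _ It (Hv t It)).
  apply Rmult_le_reg_l with e; [easy|].
  rewrite <- Rmult_assoc, Rinv_r, Rmult_1_l by lra.
  destruct (Rlt_dec 0 t) as [Pt|Pt].
  - rewrite int_mult_pos, Cmod_mult by easy.
    assert (Gt : Cmod (g t) <= t ^ (N + k) * G).
    { apply flat_order; [apply C0inf_flat| |easy]. intros y Hy. now apply c0_norm_ge. }
    assert (K := HN t x ltac:(lra) ltac:(lra)). fold e in K.
    set (e' := Cmod (int_factor p (- a)%C t)) in *.
    assert (0 <= e') by apply Cmod_ge_0.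
    apply Rle_trans with (e * (e' * (t ^ (N + k) * G))).
    { apply Rmult_le_compat_l; [lra|]. now apply Rmult_le_compat_l. }
    (* Of the N + k powers of t supplied by g, N absorb the kernel and the other k are bounded by
       x^k. *)
    rewrite pow_add.
    replace (e * (e' * (t ^ N * t ^ k * G))) with (e * e' * t ^ N * (t ^ k * G)) by ring.
    assert (t ^ k * G <= x ^ k * G).
    { apply Rmult_le_compat_r; [easy|]. apply pow_incr; lra. }
    assert (0 <= t ^ k * G) by (apply Rmult_le_pos; [apply pow_le; lra|easy]).
    nra.
  - rewrite int_mult_le_0, Cmod_0, Rmult_0_r by lra. easy. }
rewrite V0 in H. replace (v x - 0)%C with (v x) in H by ring.
rewrite Cmod_mult. fold e.
apply Rle_trans with (e * (/ e * (x ^ k * G) * x)).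
- apply Rmult_le_compat_l; [lra|easy].
- replace (e * (/ e * (x ^ k * G) * x)) with (x ^ k * G * x) by (field; lra). nra.
Qed.

(** * The pencil u |-> lambda u' - x^p u *)

(** As f vanishes at 0, its supremum is bounded by that of f'; the higher derivatives of f are
    derivatives of f'. *)
Lemma c0_norm_S (n : nat) (f : C0inf) : c0_norm (S n) f <= c0_norm n (c0_derive f).
Proof.
apply c0_norm_le. intros [|j] x Hj Hx.
- eapply Rle_trans.
  + apply (flat_order 1 f (c0_norm n (c0_derive f)) (C0inf_flat f)); [|exact Hx].
    intros y Hy. apply (c0_norm_ge n 0 (c0_derive f)); [lia|easy].
  + pose proof (c0_norm_ge_0 n (c0_derive f)). unfold I01 in Hx. nra.
- rewrite derive01_n_S. apply (c0_norm_ge n j (c0_derive f)); [lia|easy].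
Qed.

Lemma c0_norm_eq_0 (f : C0inf) : c0_norm 0 f <= 0 -> f = zero :> c0_lcs.
Proof.
intros H. apply c0_ext. intros x. simpl. destruct (I01_dec x) as [Hx|Hx].
- apply Cmod_eq_0, Rle_antisym; [|apply Cmod_ge_0].
  eapply Rle_trans; [apply (c0_norm_ge 0 0 f x); [lia|easy]|easy].
- now apply c0_outside.
Qed.

Lemma c0_norm_zero (n : nat) : c0_norm n (zero : c0_lcs) = 0.
Proof.
apply Rle_antisym; [|apply c0_norm_ge_0].
replace (zero : c0_lcs) with (scal (RtoC 0 : C_Ring) (zero : c0_lcs)).
- rewrite c0_norm_homogeneous, Cmod_0. lra.
- apply (scal_zero_r (V := c0_ModuleSpace)).
Qed.

(** The difference of the two sides has derivative 0 and vanishes at 0, so the mean value inequality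
    with constant 0 applies. *)
Lemma volterra_derive (f : C0inf) : volterra (c0_derive f) = f.
Proof.
set (d := c0_plus (volterra (c0_derive f)) (c0_opp f)).
assert (D : d = zero :> c0_lcs).
{ apply c0_norm_eq_0, c0_norm_le. intros j x Hj Hx. replace j with O by lia.
  assert (Fd : forall y, I01 y -> derive01 d y = 0%C).
  { intros y Hy. unfold d, c0_opp. simpl.
    rewrite derive01_plus, derive01_volterra, derive01_scal;
      try apply flat_derive; try apply (C0inf_flat f 1%nat); try apply C0inf_flat.
    - ring.
    - apply (volterra_flat _ (C0inf_flat (c0_derive f)) 1%nat).
    - apply (flat_scal _ _ (C0inf_flat f) 1%nat). }
  pose proof (mvt01 d 0 x Hx (proj1 (proj2 (proj2 (C0inf_flat d 1%nat))))) as H.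
  rewrite (c0_flat d 0 : d 0 = 0%C), Rmult_0_l in H.
  replace (d x - 0)%C with (d x) in H by ring. apply H.
  intros t Ht. unfold I01 in Hx. rewrite Fd, Cmod_0 by (unfold I01; lra). lra. }
apply c0_ext. intros x.
assert (E : d x = 0%C) by now rewrite D.
unfold d in E. simpl in E |- *.
replace (f x) with (volterra_fun (derive01 f) x
  - (volterra_fun (derive01 f) x + - (1) * f x))%C by ring.
rewrite E. ring.
Qed.

Lemma derive_volterra (f : C0inf) : c0_derive (volterra f) = f.
Proof.
apply c0_ext. intros x. simpl. now rewrite (derive01_volterra f (C0inf_flat f)).
Qed.

(** * A priori estimates for the differential equation *)

(** Trades a derivative of x^q u for shifts of the weight; this drives the induction in
    [ode_estimate]. *)
Lemma derive_power_mult (q p : R) (a : C) (u g : C0inf) :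
  c0_derive u = c0_plus (c0_scal a (power_mult p u)) g ->
  c0_derive (power_mult q u) =
  c0_plus (c0_scal (RtoC q) (power_mult (q - 1) u))
    (c0_plus (c0_scal a (power_mult (p + q) u)) (power_mult q g)).
Proof.
intros H. apply c0_ext. intros x. simpl.
rewrite (derive01_power_fun q u (C0inf_flat u)).
change (derive01 u) with (c0_fun (c0_derive u)). rewrite H.
f_equal. rewrite <- power_fun_comp. unfold power_fun. simpl.
unfold power_fun. destruct (Rlt_dec 0 x); ring.
Qed.

(** The function v = exp(-a W) u vanishes at 0 and satisfies v' = exp(-a W) g, so [solution_bound]
    covers every solution u. *)
Lemma ode_decay (p : R) (a : C) (N : nat) (u g : C0inf) : kernel_bound p a N ->
  c0_derive u = c0_plus (c0_scal a (power_mult p u)) g ->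
  forall k x, I01 x -> Cmod (u x) <= x ^ k * c0_norm (N + k) g.
Proof.
intros HN H k x Hx. unfold I01 in Hx.
destruct (Rlt_dec 0 x) as [Px|Px].
- pose proof (solution_bound p a N g (int_mult p (- a)%C u) HN) as B.
  specialize (B ltac:(apply int_mult_le_0; lra)).
  assert (D : forall y, I01 y -> is_derive01 (int_mult p (- a)%C u) y (int_mult p (- a)%C g y)).
  { intros y Hy.
    pose proof (int_mult_flat_is_derive01 p a N u y HN (C0inf_flat u) Hy) as D.
    refine (eq_ind _ (is_derive01 _ y) D _ _).
    change (derive01 u) with (c0_fun (c0_derive u)). rewrite H.
    unfold power_fun, int_mult. simpl. unfold power_fun.
    destruct (Rlt_dec 0 y); ring. }
  specialize (B D k x ltac:(lra)). rewrite int_mult_pos in B by easy.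
  now rewrite Cmult_assoc, int_factor_opp, Cmult_1_l in B.
- assert (x = 0) as -> by lra. rewrite (c0_flat u 0 : u 0 = 0%C), Cmod_0.
  apply Rmult_le_pos; [apply pow_le; lra|apply c0_norm_ge_0].
Qed.

(** The order m and the constant K are chosen before a: they depend on a only through [A] and [N],
    which later yields equicontinuity. All weights q are treated together in the induction on n. *)
Lemma ode_estimate (p A : R) (N n : nat) : forall q, exists m K, 0 <= K /\
  forall (a : C) (u g : C0inf), Cmod a <= A -> kernel_bound p a N ->
    c0_derive u = c0_plus (c0_scal a (power_mult p u)) g ->
    c0_norm n (power_mult q u) <= K * c0_norm m g.
Proof.
induction n as [|n IH]; intros q.
(* With k >= -q, decay of order k compensates the weight: x^q x^k <= 1. *)
- destruct (exists_INR_ge (- q)) as [k Hk].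
  exists (N + k)%nat, 1. split; [lra|]. intros a u g _ HN H.
  set (G := c0_norm (N + k) g).
  assert (G0 : 0 <= G) by apply c0_norm_ge_0.
  apply c0_norm_le. intros j x Hj Hx. replace j with O by lia.
  change (Cmod (power_fun q u x) <= 1 * G). unfold I01 in Hx.
  destruct (Rlt_dec 0 x) as [Px|Px].
  + rewrite power_fun_pos, Cmod_mult, Cmod_R by easy.
    assert (0 < Rpower x q) by apply exp_pos. rewrite Rabs_pos_eq by lra.
    apply Rle_trans with (Rpower x q * (x ^ k * G)).
    * apply Rmult_le_compat_l; [lra|]. now apply (ode_decay p a N u g).
    * rewrite <- Rmult_assoc. apply Rmult_le_compat_r; [easy|].
      apply (Rpower_pow_le q 0 k); [lra|simpl; lra].
  + rewrite power_fun_le_0, Cmod_0 by lra. lra.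
- destruct (IH (q - 1)) as [m1 [K1 [P1 H1]]], (IH (p + q)) as [m2 [K2 [P2 H2]]],
    (power_mult_bounded q n) as [m3 [K3 [P3 H3]]].
  exists (Nat.max m1 (Nat.max m2 m3)), (Rabs q * K1 + (Rmax 0 A * K2 + K3)). split.
  { pose proof (Rabs_pos q). pose proof (Rmax_l 0 A). nra. }
  intros a u g Ha HN H.
  eapply Rle_trans; [apply c0_norm_S|].
  rewrite (derive_power_mult q p a u g H).
  eapply Rle_trans; [apply c0_norm_triangle|].
  rewrite Rmult_plus_distr_r. apply Rplus_le_compat.
  + eapply Rle_trans; [right; apply c0_norm_homogeneous|].
    rewrite Cmod_R, Rmult_assoc. apply Rmult_le_compat_l; [apply Rabs_pos|].
    eapply Rle_trans; [now apply (H1 a u g)|].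
    apply Rmult_le_compat_l; [easy|]. apply c0_norm_mono. lia.
  + eapply Rle_trans; [apply c0_norm_triangle|].
    rewrite Rmult_plus_distr_r. apply Rplus_le_compat.
    * eapply Rle_trans; [right; apply c0_norm_homogeneous|].
      rewrite Rmult_assoc. apply Rmult_le_compat; [apply Cmod_ge_0|apply c0_norm_ge_0| |].
      { eapply Rle_trans; [exact Ha|apply Rmax_r]. }
      eapply Rle_trans; [now apply (H2 a u g)|].
      apply Rmult_le_compat_l; [easy|]. apply c0_norm_mono. lia.
    * eapply Rle_trans; [apply H3|].
      apply Rmult_le_compat_l; [easy|]. apply c0_norm_mono. lia.
Qed.

Definition pencil (p : R) (lambda : C) (u : C0inf) : C0inf :=
  minus (scal (lambda : C_Ring) (c0_derive u : c0_lcs)) (power_mult p u : c0_lcs).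

Lemma pencil_val (p : R) (lambda : C) (u : C0inf) (x : R) :
  pencil p lambda u x = (lambda * derive01 u x - power_fun p u x)%C.
Proof. simpl. ring. Qed.

Lemma pencil_ode (p : R) (lambda : C) (u : C0inf) : lambda <> 0%C ->
  c0_derive u = c0_plus (c0_scal (/ lambda)%C (power_mult p u))
                        (c0_scal (/ lambda)%C (pencil p lambda u)).
Proof.
intros Hl. apply c0_ext. intros x.
change (derive01 u x =
  (/ lambda * power_fun p u x + / lambda * pencil p lambda u x)%C).
rewrite pencil_val. now field.
Qed.

Lemma power_mult_0 (u : C0inf) : power_mult 0 u = u.
Proof.
apply c0_ext. intros x. simpl. destruct (Rlt_dec 0 x) as [Px|Px].
- rewrite power_fun_pos, Rpower_O by easy. ring.
- rewrite power_fun_le_0 by lra. symmetry.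
  destruct (Req_dec x 0) as [E|Nx]; [rewrite E; apply (c0_flat u 0)|].
  apply c0_outside. unfold I01. lra.
Qed.

Lemma power_mult_opp (p : R) (u : C0inf) : power_mult (- p) (power_mult p u) = u.
Proof.
rewrite <- (power_mult_0 u) at 2. apply c0_ext. intros x. simpl.
rewrite power_fun_comp. now replace (p + - p) with 0 by ring.
Qed.

(** The case q = 0 of [ode_estimate] with a = 1/lambda; dividing the right-hand side by lambda costs
    the factor [A]. *)
Lemma pencil_estimate (p A : R) (N n : nat) : exists m K, 0 <= K /\
  forall (lambda : C) (u : C0inf), lambda <> 0%C -> Cmod (/ lambda)%C <= A ->
    kernel_bound p (/ lambda)%C N ->
    c0_norm n u <= K * c0_norm m (pencil p lambda u).
Proof.
destruct (ode_estimate p A N n 0) as [m [K [PK H]]].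
exists m, (K * Rmax 0 A). split; [apply Rmult_le_pos; [easy|apply Rmax_l]|].
intros lambda u Hl HA HN.
specialize (H (/ lambda)%C u _ HA HN (pencil_ode p lambda u Hl)).
rewrite power_mult_0 in H. eapply Rle_trans; [exact H|].
rewrite Rmult_assoc. apply Rmult_le_compat_l; [easy|].
eapply Rle_trans; [right; apply c0_norm_homogeneous|].
apply Rmult_le_compat_r; [apply c0_norm_ge_0|].
eapply Rle_trans; [exact HA|apply Rmax_r].
Qed.

Lemma pencil_0 (p : R) (u : C0inf) :
  pencil p 0%C u = c0_opp (power_mult p u).
Proof.
apply c0_ext. intros x. rewrite pencil_val.
change (0 * derive01 u x - power_fun p u x = - (1) * power_fun p u x)%C. ring.
Qed.

(** At lambda = 0 the pencil is multiplication by -x^p, whose inverse, multiplication by -x^(-p), is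
    continuous too. *)
Lemma pencil_estimate_0 (p : R) (n : nat) : exists m K, 0 <= K /\
  forall u : C0inf, c0_norm n u <= K * c0_norm m (pencil p 0%C u).
Proof.
destruct (power_mult_bounded (- p) n) as [m [K [PK H]]].
exists m, K. split; [easy|]. intros u.
specialize (H (power_mult p u)). rewrite power_mult_opp in H.
rewrite pencil_0. eapply Rle_trans; [exact H|].
apply Rmult_le_compat_l; [easy|]. right. symmetry.
eapply eq_trans; [apply c0_norm_homogeneous|].
rewrite Cmod_opp, Cmod_1. ring.
Qed.

Lemma pencil_surjective_0 (p : R) (g : C0inf) : exists u, pencil p 0%C u = g.
Proof.
exists (c0_opp (power_mult (- p) g)). rewrite pencil_0. apply c0_ext. intros x.
replace (c0_fun g x) with (power_mult (- - p) (power_mult (- p) g) x)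
  by now rewrite power_mult_opp.
rewrite Ropp_involutive. simpl. unfold power_fun. destruct (Rlt_dec 0 x); ring.
Qed.

(** Variation of constants: u = exp(a W) V(exp(-a W) g) with g = a G. Its decay comes from
    [solution_bound] and its flatness from [ode_flat]. *)
Lemma pencil_surjective (p : R) (lambda : C) (N : nat) (G : C0inf) : lambda <> 0%C ->
  kernel_bound p (/ lambda)%C N -> exists u, pencil p lambda u = G.
Proof.
intros Hl HN. set (a := (/ lambda)%C) in *. set (g := c0_scal a G).
set (h := int_mult p (- a)%C g). set (v := volterra_fun h).
assert (Hv : forall x, I01 x -> is_derive01 v x (h x)).
{ intros x Hx. apply volterra_is_derive01; [easy|]. intros y Hy. eexists.
  apply (int_mult_flat_is_derive01 p a N g y HN (C0inf_flat g) Hy). }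
assert (V0 : v 0 = 0%C).
{ unfold v, volterra_fun. destruct (I01_dec 0); [|easy].
  apply (RInt_point (V := C_R_CompleteNormedModule)). }
assert (Uout : forall x, ~ I01 x -> int_mult p a v x = 0%C).
{ intros x Hx. unfold int_mult. destruct (Rlt_dec 0 x); [|easy].
  unfold v, volterra_fun. destruct (I01_dec x); [easy|ring]. }
assert (ODE : forall x, 0 < x <= 1 -> is_derive01 (int_mult p a v) x
   (a * power_fun p (int_mult p a v) x + g x)%C).
{ intros x Hx. assert (Ix : I01 x) by (unfold I01; lra).
  refine (eq_ind _ (is_derive01 _ x) (int_mult_is_derive01 p a v x _ Hx (Hv x Ix)) _ _).
  unfold h. rewrite (int_mult_pos p (- a)%C) by easy.
  now rewrite (Cmult_assoc (int_factor p a x)), int_factor_opp, Cmult_1_l. }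
assert (Fu : flat (int_mult p a v)).
{ apply (ode_flat p a _ g (C0inf_flat g)); [apply int_mult_le_0; lra|easy| |easy].
  intros k. exists (c0_norm (N + k) g). intros x Hx. unfold I01 in Hx.
  destruct (Rlt_dec 0 x) as [Px|Px].
  - rewrite int_mult_pos by easy. now apply solution_bound.
  - rewrite int_mult_le_0, Cmod_0 by lra.
    apply Rmult_le_pos; [apply pow_le; lra|apply c0_norm_ge_0]. }
exists (flat_C0inf _ Fu). apply c0_ext. intros x. rewrite pencil_val. simpl.
destruct (Rlt_dec 0 x) as [Px|Px]; [destruct (Rle_dec x 1) as [Lx|Lx]|].
- rewrite (derive01_unique _ x _ ltac:(unfold I01; lra) (ODE x ltac:(lra))).
  unfold g, a. simpl. now field.
- assert (Ix : ~ I01 x) by (unfold I01; lra).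
  rewrite derive01_outside, power_fun_outside, c0_outside by easy. ring.
- rewrite power_fun_le_0 by lra. destruct (Req_dec x 0) as [E|Nx].
  + rewrite E, (c0_flat (flat_C0inf _ Fu) 1 : derive01 (int_mult p a v) 0 = 0%C),
      (c0_flat G 0 : G 0 = 0%C). ring.
  + assert (Ix : ~ I01 x) by (unfold I01; lra).
    rewrite derive01_outside, c0_outside by easy. ring.
Qed.

(** * Eigenfunctions for p < -1 *)

(** With s = -(p + 1) > 0, W(x) = (1 - x^(-s))/s tends to minus infinity like a power of 1/x, which
    beats k ln x. *)
Lemma exp_power_primitive_decay (p alpha : R) (k : nat) : p < -1 -> 0 < alpha ->
  exists B, forall x, 0 < x <= 1 -> exp (alpha * power_primitive p x) <= x ^ k * B.
Proof.
(* Using k + 1 keeps [alpha / j] meaningful for k = 0; the spare factor x <= 1 is dropped at the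
   end. *)
intros Hp Ha. set (s := - (p + 1)). set (j := INR k + 1).
assert (s0 : 0 < s) by (unfold s; lra).
assert (j0 : 1 <= j) by (unfold j; pose proof (pos_INR k); lra).
exists (exp (alpha / s - j / s * (1 + ln (alpha / j)))). intros x Hx.
rewrite <- Rpower_pow by lra. unfold Rpower. rewrite <- exp_plus. apply exp_incr.
unfold power_primitive. destruct (Req_EM_T p (-1)); [lra|].
unfold Rpower. replace (p + 1) with (- s) by (unfold s; ring).
set (y := exp (- s * ln x)).
assert (L : ln x <= 0) by (rewrite <- ln_1; apply ln_le; lra).
(* [1 + z <= exp z] at [z = ln (alpha y / j)] *)
pose proof (exp_ineq1_le (ln (alpha / j) + - s * ln x)) as E.
assert (0 < alpha / j) by (apply Rdiv_lt_0_compat; lra).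
rewrite exp_plus, exp_ln in E by easy. fold y in E.
assert (E' : j / s * (1 + (ln (alpha / j) + - s * ln x)) <= alpha / s * y).
{ replace (alpha / s * y) with (j / s * (alpha / j * y)) by (field; lra).
  apply Rmult_le_compat_l; [|easy]. left. apply Rdiv_lt_0_compat; lra. }
replace (alpha * ((y - 1) / - s)) with (- (alpha / s * y) + alpha / s) by (field; lra).
replace (j / s * (1 + (ln (alpha / j) + - s * ln x))) with
  (j / s * (1 + ln (alpha / j)) - j * ln x) in E' by (field; lra).
unfold j in *. nra.
Qed.

(** Extended by 0, exp(a W) solves the homogeneous equation; its modulus exp(Re a W) decays rapidly,
    so [ode_flat] applies with g = 0. *)
Lemma eigenfunction (p : R) (a : C) : p < -1 -> 0 < Re a ->
  exists u : C0inf, (forall x, 0 < x <= 1 -> u x = int_factor p a x) /\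
    c0_derive u = c0_scal a (power_mult p u).
Proof.
intros Hp Ha.
(* The indicator of [0,1] makes the product vanish off [0,1], as a representative must. *)
set (one01 := fun x => if I01_dec x then 1%C else 0%C).
set (w := int_mult p a one01).
assert (Hw : forall x, 0 < x <= 1 -> w x = int_factor p a x).
{ intros x Hx. unfold w, one01. rewrite int_mult_pos by easy.
  destruct (I01_dec x) as [_|Nx]; [ring|]. exfalso. apply Nx. unfold I01. lra. }
assert (W0 : w 0 = 0%C) by (apply int_mult_le_0; lra).
assert (Wout : forall x, ~ I01 x -> w x = 0%C).
{ intros x Hx. unfold w, int_mult, one01. destruct (Rlt_dec 0 x); [|easy].
  destruct (I01_dec x); [easy|ring]. }
assert (ODE : forall x, 0 < x <= 1 ->
  is_derive01 w x (a * power_fun p w x + (fun _ => 0%C) x)%C).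
{ intros x Hx. assert (Ix : I01 x) by (unfold I01; lra).
  assert (D1 : is_derive01 one01 x 0%C).
  { apply is_derive01_eps; [easy|]. intros eps. exists eps. intros y Hy _.
    unfold one01. destruct (I01_dec x), (I01_dec y); try easy.
    replace (1 - 1 - RtoC (y - x) * 0)%C with (RtoC 0) by ring.
    rewrite Cmod_0. apply Rmult_le_pos; [left; apply eps|apply Rabs_pos]. }
  refine (eq_ind _ (is_derive01 _ x) (int_mult_is_derive01 p a _ x _ Hx D1) _ _).
  fold w. ring. }
assert (Fw : flat w).
{ apply (ode_flat p a w (fun _ => 0%C)); [apply flat_zero|easy|easy| |easy].
  intros k. destruct (exp_power_primitive_decay p (Re a) k Hp Ha) as [B HB].
  exists (Rabs B). intros x Hx. unfold I01 in Hx.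
  assert (Xk : 0 <= x ^ k) by (apply pow_le; lra).
  destruct (Rlt_dec 0 x) as [Px|Px].
  - rewrite Hw, Cmod_int_factor by easy. eapply Rle_trans; [now apply HB|].
    apply Rmult_le_compat_l; [easy|apply Rle_abs].
  - assert (x = 0) as -> by lra. rewrite W0, Cmod_0.
    apply Rmult_le_pos; [easy|apply Rabs_pos]. }
exists (flat_C0inf w Fw). split; [exact Hw|].
apply c0_ext. intros x. simpl.
destruct (Rlt_dec 0 x) as [Px|Px]; [destruct (Rle_dec x 1) as [Lx|Lx]|].
- rewrite (derive01_unique _ x _ ltac:(unfold I01; lra) (ODE x ltac:(lra))). ring.
- assert (Ix : ~ I01 x) by (unfold I01; lra).
  rewrite derive01_outside, power_fun_outside by easy. ring.
- rewrite power_fun_le_0 by lra. destruct (Req_dec x 0) as [E|Nx].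
  + rewrite E. transitivity (RtoC 0); [|ring]. apply (c0_flat (flat_C0inf w Fw) 1).
  + assert (Ix : ~ I01 x) by (unfold I01; lra).
    rewrite derive01_outside by easy. ring.
Qed.

(** * Resolvents from a priori estimates *)

(** The estimate for n = 0 gives injectivity, so preimages are unique and definite description
    yields the inverse; the estimates for all n are its continuity. *)
Lemma resolvent_set_of_estimate (T : clin c0_lcs) (lambda : C) :
  (forall g, exists f, minus (scal (lambda : C_Ring) f) (T f) = g) ->
  (forall n, exists m K, 0 <= K /\ forall f : c0_lcs,
     c0_norm n f <= K * c0_norm m (minus (scal (lambda : C_Ring) f) (T f))) ->
  resolvent_set T lambda.
Proof.
intros Hs He. set (L := fun f : c0_lcs => minus (scal (lambda : C_Ring) f) (T f) : c0_lcs).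
change (forall g, exists f, L f = g) in Hs.
change (forall n, exists m K, 0 <= K /\ forall f, c0_norm n f <= K * c0_norm m (L f)) in He.
assert (Lp : forall f g, L (plus f g) = plus (L f) (L g)).
{ intros f g. unfold L. rewrite clin_plus, (scal_distr_l (V := c0_ModuleSpace)).
  apply c0_ext. intros x. simpl. ring. }
assert (Ls : forall (a : C) f, L (scal (a : C_Ring) f) = scal (a : C_Ring) (L f)).
{ intros a f. unfold L. rewrite clin_scal. apply c0_ext. intros x. simpl. ring. }
assert (Li : forall f g, L f = L g -> f = g).
{ intros f g E. apply c0_ext. intros x.
  destruct (He O) as [m [K [_ H]]].
  specialize (H (plus f (scal ((- (1))%C : C_Ring) g))).
  rewrite Lp, Ls, E in H.
  replace (plus (L g) (scal ((- (1))%C : C_Ring) (L g))) with (zero : c0_lcs) in H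
    by (apply c0_ext; intros y; simpl; ring).
  rewrite c0_norm_zero, Rmult_0_r in H. apply c0_norm_eq_0 in H.
  assert (Hx : (f x + - (1) * g x)%C = 0%C).
  { change (c0_fun (plus f (scal ((- (1))%C : C_Ring) g) : c0_lcs) x = 0%C). now rewrite H. }
  replace (f x) with ((f x + - (1) * g x) + g x)%C by ring. rewrite Hx. ring. }
assert (U : forall g, exists! f, L f = g).
{ intros g. destruct (Hs g) as [f Hf]. exists f. split; [easy|].
  intros f' Hf'. apply Li. now rewrite Hf, Hf'. }
set (S := fun g => proj1_sig (constructive_definite_description _ (U g))).
assert (LS : forall g, L (S g) = g).
{ intros g. exact (proj2_sig (constructive_definite_description _ (U g))). }
assert (Sp : forall x y, S (plus x y) = plus (S x) (S y)).
{ intros x y. apply Li. now rewrite Lp, !LS. }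
assert (Ss : forall (a : C) x, S (scal (a : C_Ring) x) = scal (a : C_Ring) (S x)).
{ intros a x. apply Li. now rewrite Ls, !LS. }
assert (Sb : forall n : lcs_index c0_lcs, exists m K, 0 <= K /\
   forall g : c0_lcs, lcs_seminorm n (S g) <= K * lcs_seminorm m g).
{ intros n. destruct (He n) as [m [K [PK H]]]. exists m, K. split; [easy|].
  intros g. specialize (H (S g)). now rewrite LS in H. }
exists (@Clin c0_lcs S Sp Ss (lcs_bounded_continuous c0_lcs S Sp Ss Sb)).
split; intros f.
- apply Li. exact (LS (L f)).
- exact (LS f).
Qed.

(** Apply the estimate to S f, which lambda - T maps to f. The constants are uniform over W, and the
    finitely many seminorms of a neighbourhood are handled by the largest order and the smallest
    radius. *)
Lemma equicontinuous_of_estimate (T : clin c0_lcs) (W : C -> Prop) :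
  (forall n, exists m K, 0 <= K /\ forall lambda (f : c0_lcs), W lambda ->
     c0_norm n f <= K * c0_norm m (minus (scal (lambda : C_Ring) f) (T f))) ->
  equicontinuous (fun S : clin c0_lcs => exists mu, W mu /\ is_resolvent T mu S).
Proof.
intros He U [s [eps HU]].
assert (A : exists m (d : posreal), forall (S : clin c0_lcs) mu, W mu -> is_resolvent T mu S ->
  forall f : c0_lcs, c0_norm m f < d -> forall n, In n s -> c0_norm n (S f) < eps).
{ clear HU. induction s as [|n s [m [d IH]]].
  - exists O, eps. intros S mu _ _ f _ n [].
  - destruct (He n) as [m' [K [PK H]]].
    assert (P : 0 < Rmin d (eps / (K + 1))).
    { apply Rmin_pos; [apply d|]. apply Rdiv_lt_0_compat; [apply eps|lra]. }
    exists (Nat.max m m'), (mkposreal _ P). simpl. intros S mu Hmu HS f Hf n' [<-|Hn'].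
    + specialize (H mu (S f) Hmu). rewrite (proj2 HS f) in H.
      assert (Q : c0_norm m' f < eps / (K + 1)).
      { eapply Rle_lt_trans; [apply (c0_norm_mono m' (Nat.max m m')); lia|].
        eapply Rlt_le_trans; [exact Hf|apply Rmin_r]. }
      assert (E : (K + 1) * (eps / (K + 1)) = eps) by (field; lra).
      pose proof (c0_norm_ge_0 m' f). nra.
    + apply (IH S mu); try easy.
      eapply Rle_lt_trans; [apply (c0_norm_mono m (Nat.max m m')); lia|].
      eapply Rlt_le_trans; [exact Hf|apply Rmin_l]. }
assert (Z : forall f : c0_lcs, minus f zero = f).
{ intros f. unfold minus. now rewrite opp_zero, plus_zero_r. }
destruct A as [m [d HA]].
exists (fun f => c0_norm m f < d). split.
- exists (m :: nil), d. intros f Hf. specialize (Hf m (or_introl eq_refl)).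
  rewrite Z in Hf. exact Hf.
- intros S [mu [Hmu HS]] f Hf. apply HU. intros n Hn. rewrite Z.
  now apply (HA S mu).
Qed.

(** ** Reduction of both operators to the pencil *)

Lemma c0_derive_pencil (lambda : C) (f g : c0_lcs) :
  c0_derive (minus (scal (lambda : C_Ring) f) g : c0_lcs) =
  minus (scal (lambda : C_Ring) (c0_derive f : c0_lcs)) (c0_derive g : c0_lcs).
Proof.
apply c0_ext. intros x. simpl.
pose proof (C0inf_flat f) as Ff. pose proof (C0inf_flat g) as Fg.
rewrite derive01_plus, !derive01_scal.
- reflexivity.
- apply (Fg 1%nat).
- apply (Ff 1%nat).
- apply (flat_scal lambda f Ff 1%nat).
- apply (flat_scal (- (1))%C g Fg 1%nat).
Qed.

Lemma c0_norm_volterra (n : nat) (f : C0inf) : c0_norm n (volterra f) <= c0_norm n f.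
Proof.
eapply Rle_trans; [apply (c0_norm_mono n (S n)); lia|].
eapply Rle_trans; [apply c0_norm_S|]. rewrite derive_volterra. lra.
Qed.

(** The factorisation Q (lambda - T) = pencil P with bijections P, Q that do not depend on lambda: P
    = V and Q = id for T = M V, P = id and Q = d/dx for T = V M. The norm bounds record a loss of at
    most one derivative. *)
Lemma pencil_reduction (p : R) (T : clin c0_lcs) :
  T = clin_comp (power_op p) volterra_op \/ T = clin_comp volterra_op (power_op p) ->
  exists P P' Q Q' : C0inf -> C0inf,
    (forall u, P (P' u) = u) /\ (forall f, P' (P f) = f) /\
    (forall g, Q (Q' g) = g) /\ (forall g, Q' (Q g) = g) /\
    (forall (lambda : C) (f : c0_lcs),
       Q (minus (scal (lambda : C_Ring) f) (T f) : c0_lcs) = pencil p lambda (P f)) /\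
    (forall n u, c0_norm n (P' u) <= c0_norm (S n) u) /\
    (forall n g, c0_norm n (Q g) <= c0_norm (S n) g) /\
    (forall n g, c0_norm n (Q' g) <= c0_norm n g) /\
    (forall f, c0_norm 0 (P f) <= c0_norm 0 f).
Proof.
intros [-> | ->].
- exists volterra, c0_derive, (fun g => g), (fun g => g).
  split; [exact volterra_derive|]. split; [exact derive_volterra|]. do 2 (split; [easy|]).
  split; [|split; [|split; [|split]]].
  + intros lambda f. unfold pencil. now rewrite derive_volterra.
  + exact c0_norm_derive.
  + intros n g. apply c0_norm_mono. lia.
  + intros n g. apply Rle_refl.
  + apply c0_norm_volterra.
- exists (fun g => g), (fun g => g), c0_derive, volterra.
  do 2 (split; [easy|]). split; [exact derive_volterra|]. split; [exact volterra_derive|].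
  split; [|split; [|split; [|split]]].
  + intros lambda f. rewrite c0_derive_pencil.
    change (c0_derive (clin_comp volterra_op (power_op p) f)) with
      (c0_derive (volterra (power_mult p f))).
    now rewrite derive_volterra.
  + intros n u. apply c0_norm_mono. lia.
  + exact c0_norm_derive.
  + exact c0_norm_volterra.
  + intros f. apply Rle_refl.
Qed.

Definition factor_order (p : R) (T : clin c0_lcs) : Prop :=
  T = clin_comp (power_op p) volterra_op \/ T = clin_comp volterra_op (power_op p).

Lemma surjective_of_pencil (p : R) (T : clin c0_lcs) (lambda : C) : factor_order p T ->
  (forall g, exists u, pencil p lambda u = g) ->
  forall g, exists f, minus (scal (lambda : C_Ring) f) (T f) = g.
Proof.
intros HT Hs g.
destruct (pencil_reduction p T HT) as (P & P' & Q & Q' & PP & _ & _ & Q'Q & HL & _).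
destruct (Hs (Q g)) as [u Hu]. exists (P' u).
rewrite <- (Q'Q (minus _ _)), HL, PP, Hu. apply Q'Q.
Qed.

Lemma estimate_of_pencil (p : R) (T : clin c0_lcs) (W : C -> Prop) : factor_order p T ->
  (forall n, exists m K, 0 <= K /\ forall lambda u, W lambda ->
     c0_norm n u <= K * c0_norm m (pencil p lambda u)) ->
  forall n, exists m K, 0 <= K /\ forall lambda (f : c0_lcs), W lambda ->
     c0_norm n f <= K * c0_norm m (minus (scal (lambda : C_Ring) f) (T f)).
Proof.
intros HT He n.
destruct (pencil_reduction p T HT) as (P & P' & Q & Q' & _ & P'P & _ & _ & HL & NP & NQ & _).
(* [S n] allows for P' being the derivative, [S m] for Q being the derivative. *)
destruct (He (S n)) as [m [K [PK H]]]. exists (S m), K. split; [easy|].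
intros lambda f Hl. rewrite <- (P'P f) at 1.
eapply Rle_trans; [apply NP|]. eapply Rle_trans; [now apply (H lambda)|].
apply Rmult_le_compat_l; [easy|]. rewrite <- HL. apply NQ.
Qed.

(** Multiplication by x^p is an isomorphism for every real p; the estimate is transferred with the
    singleton {0} as parameter set. *)
Lemma resolvent_set_0 (p : R) (T : clin c0_lcs) : factor_order p T ->
  resolvent_set T (RtoC 0).
Proof.
intros HT. apply resolvent_set_of_estimate.
- apply (surjective_of_pencil p T); [easy|]. apply pencil_surjective_0.
- intros n. destruct (estimate_of_pencil p T (fun l => l = RtoC 0) HT) with n
    as [m [K [PK H]]].
  + intros k. destruct (pencil_estimate_0 p k) as [m [K [PK H]]].
    exists m, K. split; [easy|]. intros lambda u ->. apply H.
  + exists m, K. split; [easy|]. intros f. now apply H.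
Qed.

(** * Parameters with a bounded kernel *)

(** For fixed [A] and [N], a set of parameters on which the resolvent estimates are uniform. *)
Definition kernel_bounded_at (p A : R) (N : nat) (lambda : C) : Prop :=
  lambda <> 0%C /\ Cmod (/ lambda)%C <= A /\ kernel_bound p (/ lambda)%C N.

Lemma kernel_estimate (p A : R) (N : nat) (T : clin c0_lcs) : factor_order p T ->
  forall n, exists m K, 0 <= K /\ forall lambda (f : c0_lcs), kernel_bounded_at p A N lambda ->
     c0_norm n f <= K * c0_norm m (minus (scal (lambda : C_Ring) f) (T f)).
Proof.
intros HT. apply (estimate_of_pencil p T); [easy|]. intros n.
destruct (pencil_estimate p A N n) as [m [K [PK H]]].
exists m, K. split; [easy|]. intros lambda u (H1 & H2 & H3). now apply H.
Qed.

Lemma resolvent_set_kernel (p A : R) (N : nat) (T : clin c0_lcs) (lambda : C) :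
  factor_order p T -> kernel_bounded_at p A N lambda -> resolvent_set T lambda.
Proof.
intros HT Hl. apply resolvent_set_of_estimate.
- apply (surjective_of_pencil p T); [easy|]. intros g.
  now apply (pencil_surjective p lambda N); apply Hl.
- intros n. destruct (kernel_estimate p A N T HT n) as [m [K [PK H]]].
  exists m, K. split; [easy|]. intros f. now apply H.
Qed.

Lemma waelbroeck_resolvent_set_kernel (p A : R) (N : nat) (T : clin c0_lcs) (lambda : C) :
  factor_order p T -> locally lambda (kernel_bounded_at p A N) ->
  waelbroeck_resolvent_set T lambda.
Proof.
intros HT Hl. split.
- apply (resolvent_set_kernel p A N); [easy|]. now apply locally_singleton.
- exists (kernel_bounded_at p A N). split; [easy|]. split.
  + intros mu. now apply resolvent_set_kernel.
  + apply equicontinuous_of_estimate. now apply kernel_estimate.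
Qed.

(** * Neighbourhoods and inverses in the complex plane *)

(** Balls of C are squares here; the half side d/2 absorbs the factor sqrt 2 between the modulus and
    the largest coordinate. *)
Lemma locally_Cmod (z : C) (d : R) : 0 < d -> locally z (fun w : C => Cmod (w - z)%C < d).
Proof.
intros Hd. assert (P : 0 < d / 2) by lra.
exists (mkposreal _ P). intros w [H1 H2].
change (Rabs (fst w - fst z) < d / 2) in H1. change (Rabs (snd w - snd z) < d / 2) in H2.
eapply Rle_lt_trans; [apply Cmod_2Rmax|].
change (fst (w - z)%C) with (fst w - fst z). change (snd (w - z)%C) with (snd w - snd z).
assert (M : Rmax (Rabs (fst w - fst z)) (Rabs (snd w - snd z)) < d / 2) by now apply Rmax_lub_lt.
assert (M0 : 0 <= Rmax (Rabs (fst w - fst z)) (Rabs (snd w - snd z))).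
{ eapply Rle_trans; [apply Rabs_pos|apply Rmax_l]. }
assert (S2 : sqrt 2 <= 2).
{ rewrite <- (sqrt_pow2 2) at 2 by lra. apply sqrt_le_1; lra. }
nra.
Qed.

Lemma locally_Cinv_bounded (z : C) : z <> 0%C ->
  locally z (fun w : C => w <> RtoC 0 /\ Cmod (/ w)%C <= 2 / Cmod z).
Proof.
intros Hz. assert (P : 0 < Cmod z) by now apply Cmod_gt_0.
apply filter_imp with (2 := locally_Cmod z (Cmod z / 2) ltac:(lra)).
intros w Hw.
assert (L : Cmod z / 2 < Cmod w).
{ pose proof (Cmod_diff w z) as D. apply Rabs_le_between in D. lra. }
assert (W0 : w <> 0%C) by (intros ->; rewrite Cmod_0 in L; lra).
split; [easy|]. rewrite Cmod_inv by easy.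
replace (2 / Cmod z) with (/ (Cmod z / 2)) by (field; lra).
apply Rinv_le_contravar; lra.
Qed.

(** Here r = 1/|z|^2; it is used to carry the sign of Re lambda over to a = 1/lambda. *)
Lemma Re_Cinv_sign (z : C) : z <> 0%C -> exists r, 0 < r /\ Re (/ z)%C = r * Re z.
Proof.
intros Hz. assert (P : 0 < fst z ^ 2 + snd z ^ 2).
{ destruct (Cmod_gt_0 z) as [G _]. specialize (G Hz). unfold Cmod in G.
  destruct (Rle_lt_dec (fst z ^ 2 + snd z ^ 2) 0) as [L|L]; [|easy].
  rewrite sqrt_neg_0 in G by easy. lra. }
exists (/ (fst z ^ 2 + snd z ^ 2)). split; [now apply Rinv_0_lt_compat|].
destruct z as [x y]. simpl in *. field. lra.
Qed.

(** ** The point 0 in the case -1 <= p *)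

Lemma int_factor_real (p a x : R) :
  int_factor p (RtoC a) x = RtoC (exp (a * power_primitive p x)).
Proof.
unfold int_factor, RtoC. simpl. rewrite Rmult_0_l, cos_0, sin_0. f_equal; ring.
Qed.

Lemma Re_increment_ge_0 (z : R -> C) :
  (forall x, I01 x -> exists l, is_derive01 z x l /\ 0 <= Re l) ->
  Re (z 0) <= Re (z 1).
Proof.
intros H.
assert (Hz : forall x, I01 x -> exists l, is_derive01 z x l).
{ intros x Hx. destruct (H x Hx) as [l [Hl _]]. now exists l. }
(* The factor 1 gives the function the shape required by [is_derive01_re]. *)
destruct (MVT_gen (fun y => Re (1 * z (clamp y))%C) 0 1 (fun t => Re (1 * derive01 z t)%C))
  as [c [Hc E]].
- rewrite Rmin_left, Rmax_right by lra. intros x Hx.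
  apply is_derive01_re; [easy|]. apply derive01_correct; [|apply Hz]; unfold I01; lra.
- intros t _. apply continuity_pt_locally. intros eps.
  destruct (clamp_continuous z Hz t eps) as [d Hd].
  exists d. intros y Hy. eapply Rle_lt_trans; [|exact (Hd y Hy)].
  rewrite !Cmult_1_l. apply (Re_le_Cmod (z (clamp y) - z (clamp t))%C).
- rewrite Rmin_left, Rmax_right in Hc by lra.
  rewrite !clamp_id, !Cmult_1_l in E by (unfold I01; lra).
  destruct (H c Hc) as [l [Hl L0]].
  rewrite (derive01_unique z c l Hc Hl) in E. lra.
Qed.

(** The witness is [exp (1 - 1/x)], the eigenfunction for p = -2 and a = 1. *)
Lemma flat_increasing_function : exists e : C0inf, e 1 = 1%C /\
  forall x, I01 x -> exists r, 0 <= r /\ derive01 e x = RtoC r.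
Proof.
destruct (eigenfunction (-2) 1%C) as [e [He De]]; [lra|simpl; lra|].
exists e. split; [rewrite He by lra; apply int_factor_1|].
intros x Hx. change (derive01 e x) with (c0_fun (c0_derive e) x). rewrite De. simpl.
unfold I01 in Hx. destruct (Rlt_dec 0 x) as [Px|Px].
- exists (Rpower x (-2) * exp (1 * power_primitive (-2) x)). split.
  + left. apply Rmult_lt_0_compat; apply exp_pos.
  + rewrite power_fun_pos, He, int_factor_real, RtoC_mult by easy. ring.
- exists 0. split; [lra|]. rewrite power_fun_le_0 by lra. ring.
Qed.

(** With mu = 1/lambda and v = exp(-mu W) u, v' = mu c exp(-mu W) e' >= mu c e' because W <= 0 on
    (0,1]. Integrating from 0 to 1 gives Re u(1) >= mu c. *)
Lemma pencil_solution_growth (p lambda c : R) (N : nat) (u e : C0inf) :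
  0 < lambda -> 0 <= c -> kernel_bound p (/ lambda)%C N ->
  e 1 = 1%C -> (forall x, I01 x -> exists r, 0 <= r /\ derive01 e x = RtoC r) ->
  pencil p lambda u = c0_scal (RtoC c) (c0_derive e) ->
  c / lambda <= c0_norm 0 u.
Proof.
intros Hl Hc HN E1 De Hu.
rewrite <- RtoC_inv in HN by lra. set (mu := / lambda) in *.
assert (mu0 : 0 < mu) by now apply Rinv_0_lt_compat.
assert (Hl0 : RtoC lambda <> 0%C) by (intros E; apply RtoC_inj in E; lra).
pose proof (pencil_ode p lambda u Hl0) as ODE. rewrite Hu, <- RtoC_inv in ODE by lra. fold mu in ODE.
set (v := int_mult p (- RtoC mu)%C u).
(* The difference v - mu c e vanishes at 0, equals u(1) - mu c at 1, and has a derivative with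
   nonnegative real part. *)
set (z := fun x => (v x + RtoC (- (mu * c)) * e x)%C).
assert (Z : Re (z 0) <= Re (z 1)).
{ apply Re_increment_ge_0. intros x Hx. destruct (De x Hx) as [r [r0 Hr]].
  pose proof (int_mult_flat_is_derive01 p mu N u x HN (C0inf_flat u) Hx) as D1.
  pose proof (is_derive01_scal (RtoC (- (mu * c))) e x _ Hx (flat_diff e x (C0inf_flat e) Hx)) as D2.
  eexists. split; [exact (is_derive01_plus _ _ _ _ _ D1 D2)|].
  change (derive01 u) with (c0_fun (c0_derive u)). rewrite ODE, Hr.
  unfold I01 in Hx. destruct (Rlt_dec 0 x) as [Px|Px].
  - rewrite power_fun_pos, !int_mult_pos by easy. simpl c0_fun. rewrite power_fun_pos, Hr by easy.
    rewrite <- RtoC_opp, int_factor_real.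
    set (q := exp (- mu * power_primitive p x)).
    assert (q1 : 1 <= q).
    { unfold q. rewrite <- exp_0. apply exp_incr.
      pose proof (power_primitive_incr p x 1 ltac:(lra)) as W.
      rewrite power_primitive_1 in W. nra. }
    match goal with |- 0 <= Re ?w => replace w with (RtoC ((q - 1) * (mu * c * r))) end.
    + simpl. apply Rmult_le_pos; [lra|]. apply Rmult_le_pos; [|easy]. nra.
    + rewrite !RtoC_mult, RtoC_minus, !RtoC_opp, !RtoC_mult. ring.
  - assert (x = 0) as -> by lra.
    assert (r = 0) as ->.
    { apply RtoC_inj. rewrite <- Hr. apply (c0_flat e 1). }
    rewrite power_fun_le_0, int_mult_le_0 by lra. simpl. lra. }
unfold z, v in Z. rewrite E1, int_mult_le_0, int_mult_pos in Z by lra.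
rewrite (c0_flat e 0 : e 0 = 0%C) in Z.
replace (- RtoC mu)%C with (- mu)%C in Z by easy.
rewrite int_factor_1 in Z.
assert (B : c / lambda <= Re (u 1)).
{ unfold Rdiv. fold mu. simpl in Z. unfold Re. lra. }
eapply Rle_trans; [exact B|]. eapply Rle_trans; [apply Rle_abs|].
eapply Rle_trans; [apply Re_le_Cmod|]. apply (c0_norm_ge 0 0 u 1); [lia|unfold I01; lra].
Qed.

(** Equicontinuity would bound all resolvents near 0 on one fixed small multiple of the test
    function, against the growth c/lambda as lambda decreases to 0. *)
Lemma waelbroeck_spectrum_0 (p : R) (T : clin c0_lcs) : factor_order p T -> -1 <= p ->
  waelbroeck_spectrum T (RtoC 0).
Proof.
intros HT Hp [_ [W [HW [HR HE]]]].
destruct (pencil_reduction p T HT) as (P & P' & Q & Q' & _ & _ & QQ' & _ & HL & _ & _ & NQ' & NP).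
destruct flat_increasing_function as [e [E1 De]].
assert (Z : forall f : c0_lcs, minus f zero = f).
{ intros f. unfold minus. now rewrite opp_zero, plus_zero_r. }
destruct (HE (fun f => c0_norm 0 f < 1)) as [W' [[s [eps HW']] HS]].
{ exists (O :: nil), (mkposreal 1 Rlt_0_1). intros f Hf.
  specialize (Hf O (or_introl eq_refl)). rewrite Z in Hf. exact Hf. }
(* The scale c is fixed before lambda, small enough for the test function to lie in [W']. *)
assert (Hc : exists c, 0 < c /\ forall n, In n s -> c * c0_norm n (c0_derive e) < eps).
{ clear HW'. induction s as [|n s [c [c0 IH]]].
  - exists 1. split; [lra|]. intros n [].
  - set (G := c0_norm n (c0_derive e)). assert (G0 : 0 <= G) by apply c0_norm_ge_0.
    assert (Q0 : 0 < eps / (G + 1)) by (apply Rdiv_lt_0_compat; [apply eps|lra]).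
    exists (Rmin c (eps / (G + 1))). split; [now apply Rmin_pos|].
    intros k [<-|Hk].
    + fold G. assert (E : (G + 1) * (eps / (G + 1)) = eps) by (field; lra).
      pose proof (Rmin_r c (eps / (G + 1))). nra.
    + eapply Rle_lt_trans; [|now apply (IH k)].
      apply Rmult_le_compat_r; [apply c0_norm_ge_0|apply Rmin_l]. }
destruct Hc as [c [c0 Hc]].
set (g := Q' (c0_scal (RtoC c) (c0_derive e))).
assert (Wg : W' g).
{ apply HW'. intros n Hn. rewrite Z. eapply Rle_lt_trans; [apply NQ'|].
  eapply Rle_lt_trans; [right; apply c0_norm_homogeneous|].
  rewrite Cmod_R, Rabs_pos_eq by lra. now apply Hc. }
destruct HW as [d Hd].
(* The bound by d puts lambda in [W]; the bound by c makes c/lambda > 1. *)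
assert (Hlam : exists lambda, 0 < lambda /\ lambda < c /\ lambda < d).
{ assert (0 < Rmin c d) by (apply Rmin_pos; [easy|apply d]).
  pose proof (Rmin_l c d). pose proof (Rmin_r c d). exists (Rmin c d / 2). lra. }
destruct Hlam as (lambda & l0 & lc & ld).
assert (Wl : W lambda).
{ apply Hd. split.
  - change (Rabs (lambda - 0) < d). rewrite Rminus_0_r, Rabs_pos_eq; lra.
  - change (Rabs (0 - 0) < d). rewrite Rminus_0_r, Rabs_R0. apply d. }
destruct (HR lambda Wl) as [S RS].
assert (B := HS S (ex_intro _ (RtoC lambda) (conj Wl RS)) g Wg).
destruct (exists_INR_ge (Cmod (/ lambda)%C)) as [N HN].
pose proof (pencil_solution_growth p lambda c N (P (S g)) e l0 ltac:(lra)
  (kernel_bound_ge p _ N Hp HN) E1 De) as L.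
rewrite <- HL, (proj2 RS g) in L. specialize (L (QQ' _)).
pose proof (NP (S g)) as L'. simpl in B.
(* Contradiction: 1 < c/lambda, while c/lambda is at most the norm of P (S g), hence of S g, which
   is below 1. *)
assert (c / lambda * lambda = c) by (field; lra). nra.
Qed.

(** * Eigenvalues and half-planes *)

Lemma minus_eq_zero (G : AbelianGroup) (x y : G) : minus x y = zero -> x = y.
Proof.
intros E. transitivity (plus (minus x y) y).
- unfold minus. now rewrite <- plus_assoc, plus_opp_l, plus_zero_r.
- rewrite E. apply plus_zero_l.
Qed.

(** The function exp(W/lambda) lies in the kernel of the pencil, and P' carries it into that of
    lambda - T. *)
Lemma point_spectrum_of_Re_pos (p : R) (T : clin c0_lcs) (lambda : C) :
  factor_order p T -> p < -1 -> 0 < Re lambda -> point_spectrum T lambda.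
Proof.
intros HT Hp Hl.
assert (Hl0 : lambda <> 0%C) by (intros ->; simpl in Hl; lra).
destruct (Re_Cinv_sign lambda Hl0) as [r [r0 Hr]].
destruct (eigenfunction p (/ lambda)%C Hp) as [u [Hu Du]]; [rewrite Hr; now apply Rmult_lt_0_compat|].
destruct (pencil_reduction p T HT) as (P & P' & Q & Q' & PP & _ & _ & Q'Q & HL & _ & NQ & _ & NP).
(* Q is known only as a map, so its value at zero is read off its norm bound. *)
assert (Q0 : Q (zero : c0_lcs) = (zero : c0_lcs)).
{ apply c0_norm_eq_0. eapply Rle_trans; [apply NQ|]. rewrite c0_norm_zero. lra. }
assert (L0 : pencil p lambda u = (zero : c0_lcs)).
{ apply c0_ext. intros x. rewrite pencil_val.
  change (derive01 u x) with (c0_fun (c0_derive u) x). rewrite Du. simpl. now field. }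
exists (P' u). split.
(* If P' u were zero, the norm bound on P would give u = 0, against u(1) = 1. *)
- intros E. assert (U0 : c0_norm 0 u <= 0).
  { rewrite <- (PP u), E. eapply Rle_trans; [apply NP|]. rewrite c0_norm_zero. lra. }
  apply c0_norm_eq_0 in U0.
  assert (U1 : u 1 = 0%C) by now rewrite U0.
  rewrite Hu, int_factor_1 in U1 by lra. apply RtoC_inj in U1. lra.
- assert (E : minus (scal (lambda : C_Ring) (P' u : c0_lcs)) (T (P' u)) = (zero : c0_lcs)).
  { rewrite <- (Q'Q (minus _ _)), HL, PP, L0.
  transitivity (Q' (Q (zero : c0_lcs))); [f_equal; now symmetry|apply Q'Q]. }
  symmetry. exact (minus_eq_zero _ _ _ E).
Qed.

Lemma spectrum_of_point_spectrum (X : lcs) (T : clin X) (lambda : C) :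
  point_spectrum T lambda -> spectrum T lambda.
Proof.
intros [f [Nf Hf]] [S [HS _]]. apply Nf.
assert (S0 : S zero = zero).
{ transitivity (S (scal (RtoC 0 : C_Ring) zero)).
  - f_equal. symmetry. apply (scal_zero_r (V := X)).
  - rewrite clin_scal. apply (scal_zero_l (V := X)). }
rewrite <- (HS f), Hf. transitivity (S zero); [|easy]. f_equal. apply (plus_opp_r (G := X)).
Qed.

(** For nonzero lambda, Re(1/lambda) <= 0 and the kernel is bounded by 1; 0 is treated
    separately. *)
Lemma resolvent_set_of_Re_npos (p : R) (T : clin c0_lcs) (lambda : C) :
  factor_order p T -> Re lambda <= 0 -> resolvent_set T lambda.
Proof.
intros HT Hl. destruct (Ceq_dec lambda 0%C) as [->|Hl0]; [now apply (resolvent_set_0 p)|].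
apply (resolvent_set_kernel p (Cmod (/ lambda)%C) 0 T); [easy|].
split; [easy|]. split; [lra|]. apply kernel_bound_npos.
destruct (Re_Cinv_sign lambda Hl0) as [r [r0 ->]]. nra.
Qed.

(** The disc of radius -Re lambda stays in the open left half-plane, so the kernel bound 1 is
    uniform near lambda. *)
Lemma waelbroeck_resolvent_set_of_Re_neg (p : R) (T : clin c0_lcs) (lambda : C) :
  factor_order p T -> Re lambda < 0 -> waelbroeck_resolvent_set T lambda.
Proof.
intros HT Hl.
assert (Hl0 : lambda <> 0%C) by (intros ->; simpl in Hl; lra).
apply (waelbroeck_resolvent_set_kernel p (2 / Cmod lambda) 0 T); [easy|].
apply filter_imp with (2 := filter_and _ _ (locally_Cinv_bounded lambda Hl0)
  (locally_Cmod lambda (- Re lambda) ltac:(lra))).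
intros w [[W0 WA] Wd]. split; [easy|]. split; [easy|]. apply kernel_bound_npos.
destruct (Re_Cinv_sign w W0) as [r [r0 ->]].
pose proof (Rle_trans _ _ _ (Rle_abs _) (Re_le_Cmod (w - lambda)%C)) as B.
change (Re (w - lambda)%C) with (Re w - Re lambda) in B. nra.
Qed.

Lemma closure_Re_pos (A : C -> Prop) (lambda : C) :
  (forall w, 0 < Re w -> A w) -> 0 <= Re lambda -> closureC A lambda.
Proof.
intros HA Hl U [d Hd].
assert (d0 : 0 < d) by apply d.
exists (lambda + RtoC (d / 2))%C. split.
- apply Hd. split.
  + change (Rabs (fst lambda + d / 2 - fst lambda) < d).
    replace (fst lambda + d / 2 - fst lambda) with (d / 2) by ring. rewrite Rabs_pos_eq; lra.
  + change (Rabs (snd lambda + 0 - snd lambda) < d).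
    replace (snd lambda + 0 - snd lambda) with 0 by ring. now rewrite Rabs_R0.
- apply HA. change (0 < Re lambda + d / 2). lra.
Qed.

Theorem theorem20 :
  forall (p : R) (T : clin c0_lcs),
    T = clin_comp (power_op p) volterra_op \/ T = clin_comp volterra_op (power_op p) ->
    (-1 <= p ->
      (forall lambda : C, ~ spectrum T lambda) /\
      (forall lambda : C, waelbroeck_spectrum T lambda <-> lambda = RtoC 0)) /\
    (p < -1 ->
      (forall lambda : C, spectrum T lambda <-> point_spectrum T lambda) /\
      (forall lambda : C, point_spectrum T lambda <-> 0 < Re lambda) /\
      (forall lambda : C, waelbroeck_spectrum T lambda <-> closureC (spectrum T) lambda)).
Proof.
intros p T HT. fold (factor_order p T) in HT. split; intros Hp.
- assert (HW : forall lambda, lambda <> RtoC 0 -> waelbroeck_resolvent_set T lambda).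
  (* One N dominates |1/w| for all w near lambda. *)
  { intros lambda Hl. destruct (exists_INR_ge (2 / Cmod lambda)) as [N HN].
    apply (waelbroeck_resolvent_set_kernel p (2 / Cmod lambda) N T); [easy|].
    apply filter_imp with (2 := locally_Cinv_bounded lambda Hl).
    intros w [W0 WA]. split; [easy|]. split; [easy|].
    apply kernel_bound_ge; [easy|]. lra. }
  split; intros lambda.
  + intros H. apply H. destruct (Ceq_dec lambda 0%C) as [->|Hl].
    * now apply (resolvent_set_0 p).
    * apply (HW lambda Hl).
  + split; [|intros ->; now apply (waelbroeck_spectrum_0 p)].
    intros H. destruct (Ceq_dec lambda 0%C) as [E|Hl]; [easy|].
    now destruct (H (HW lambda Hl)).
- assert (HR : forall lambda, spectrum T lambda -> 0 < Re lambda).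
  { intros lambda H. apply Rnot_le_lt. intros L. now apply H, (resolvent_set_of_Re_npos p). }
  assert (HP : forall lambda, 0 < Re lambda -> point_spectrum T lambda).
  { intros lambda. now apply (point_spectrum_of_Re_pos p). }
  assert (HS := spectrum_of_point_spectrum c0_lcs T).
  split; [|split]; intros lambda; split; intros H; auto.
  + apply closure_Re_pos; [auto|]. apply Rnot_lt_le. intros L.
    now apply H, (waelbroeck_resolvent_set_of_Re_neg p).
  (* A neighbourhood contained in the resolvent set cannot meet the spectrum. *)
  + intros [_ [W [HW [WR _]]]]. destruct (H W HW) as [w [Ww Sw]]. now apply Sw, WR.
Qed.
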